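(* Let $X$ be a real Banach lattice which is a dual Banach space, $X=Y^*$ for some fixed Banach space $Y$. Let $\mathcal C$ be a collection of positive adjoint operators on $X$. If $\mathcal C$ is finitely quasinilpotent at some $x_0>0$ in $X$, then there exist non-zero $x\in X_+$ and non-zero $f\in X^*_+$ such that $\langle f,Tx\rangle\le\lVert T_*\rVert_e$ for all $T\in\mathcal E_{\mathcal C}$.
   Context: $L(Z)$ denotes the space of bounded linear operators on a Banach space $Z$. $X_+$, $X^*_+$, $L(X)_+$ denote the cones of positive elements of $X$, $X^*$, $L(X)$ (an operator $T\in L(X)$ is positive if $T(X_+)\subseteq X_+$; $S\le T$ means $T-S\in L(X)_+$); $x_0>0$ means $x_0\in X_+$, $x_0\neq0$. An operator $T\in L(X)$ is called adjoint (with respect to the fixed predual $Y$) if $T=S^*$ for some $S\in L(Y)$; this $S$ is unique and is denoted $T_*$. For $S\in L(Y)$, $\lVert S\rVert_e$ is the essential norm, i.e. the distance in operator norm from $S$ to the space of compact operators on $Y$. For collections $\mathcal C,\mathcal D$ of operators, $\mathcal C\mathcal D=\{TS: T\in\mathcal C,\ S\in\mathcal D\}$, and $\mathcal C^n$ is the product of $n$ copies of $\mathcal C$. For a subset $U\subseteq X$, $\lVert U\rVert=\sup\{\lVert x\rVert: x\in U\}$. A collection $\mathcal C$ of operators is finitely quasinilpotent at $x\in X$ if $\limsup_n\lVert\mathcal F^nx\rVert^{1/n}=0$ for every finite subcollection $\mathcal F$ of $\mathcal C$, where $\mathcal F^nx=\{Tx:T\in\mathcal F^n\}$. The super right commutant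 of $\mathcal C$ is $[\mathcal C\rangle=\{S\in L(X)_+ : ST\ge TS\text{ for each }T\in\mathcal C\}$. Define $$\mathcal D_{\mathcal C}=\Bigl\{D\in L(X)_+ : \exists\, k\ge 1,\ T_1,\dots,T_k\in[\mathcal C\rangle,\ S_1,\dots,S_k\in\bigcup_{n=1}^\infty\mathcal C^n\text{ such that }D\le\sum_{i=1}^kT_iS_i\Bigr\}$$ and $$\mathcal E_{\mathcal C}=\{T\in\mathcal D_{\mathcal C} : T=S^*\text{ for some }S\in L(Y)\}.$$ *)

(* Defs.v *)
From HB Require Import structures.
From mathcomp Require Import all_boot all_order all_algebra.
From mathcomp Require Import all_classical all_reals all_analysis.
Import Order.TTheory GRing.Theory Num.Theory numFieldNormedType.Exports.

Set Implicit Arguments.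
Unset Strict Implicit.
Unset Printing Implicit Defensive.

Local Open Scope classical_set_scope.
Local Open Scope ring_scope.

(* A Banach lattice is a Banach space which is a vector lattice and whose norm
   is monotone in the modulus, the join of [x] and [- x].  The order is a field
   of the mixin: in the hierarchy [numDomainType] inherits both from partial
   orders and from normed groups, which have no declared join, so that a
   structure inheriting from both families cannot be declared afterwards. *)
HB.mixin Record isBanachLattice (R : realType) X
    of CompleteNormedModule R X := {
  bl_le : rel X;
  bl_join : X -> X -> X;
  bl_meet : X -> X -> X;
  bl_le_refl : reflexive bl_le;
  bl_le_anti : antisymmetric bl_le;
  bl_le_trans : transitive bl_le;
  bl_joinP : forall x y z : X,
    bl_le (bl_join x y) z = bl_le x z && bl_le y z;
  bl_meetP : forall x y z : X,
    bl_le z (bl_meet x y) = bl_le z x && bl_le z y;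
  bl_leD2r : forall x y z : X, bl_le x y -> bl_le (x + z) (y + z);
  bl_scale_ge0 : forall (a : R) (x : X),
    0 <= a -> bl_le 0 x -> bl_le 0 (a *: x);
  bl_norm_le : forall x y : X,
    bl_le (bl_join x (- x)) (bl_join y (- y)) -> `|x| <= `|y|
}.

#[short(type="banachLatticeType")]
HB.structure Definition BanachLattice (R : realType) :=
  {X of CompleteNormedModule R X & isBanachLattice R X}.

Definition positive_cone (R : realType) (X : banachLatticeType R) : set X :=
  [set x | bl_le 0 x].

Section BoundedOperators.
Context {R : realType}.

Definition bounded_op (V W : normedModType R) : set (V -> W) :=
  [set T | linear T /\ exists M : R, forall v, `|T v| <= M * `|v|].

Definition opnorm (V W : normedModType R) (T : V -> W) : R :=
  sup [set `|T v| | v in [set v : V | `|v| <= 1]].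

Definition compact_op (V W : normedModType R) : set (V -> W) :=
  [set K | bounded_op K /\
           compact (closure (K @` [set v : V | `|v| <= 1]))].

Definition essnorm (V : normedModType R) (S : V -> V) : R :=
  inf [set opnorm (S \- K) | K in @compact_op V V].

Definition dual (V : normedModType R) : set (V -> R^o) := @bounded_op V R^o.

(* [iota] is an isometric isomorphism of [X] onto [Y]^*; this is what
   identifies [X] with [Y]^*, [iota x y] being the value at [y] of the
   functional [x]. *)
Definition dual_identification (X Y : normedModType R) (iota : X -> Y -> R^o) :=
  [/\ linear iota,
      range iota = @dual Y
    & forall x, opnorm (iota x) = `|x|].

Definition is_adjoint (X Y : normedModType R) (iota : X -> Y -> R^o)
    (T : X -> X) (S : Y -> Y) :=
  forall x y, iota (T x) y = iota x (S y).

Definition preadjoints (X Y : normedModType R) (iota : X -> Y -> R^o)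
    (T : X -> X) : set (Y -> Y) :=
  [set S | bounded_op S /\ is_adjoint iota T S].

(* The operator T_*; the default value is irrelevant for adjoint [T]. *)
Definition preadjoint (X Y : normedModType R) (iota : X -> Y -> R^o)
    (T : X -> X) : Y -> Y :=
  xget (@idfun Y : Y -> Y) (preadjoints iota T).

Definition adjoint_op (X Y : normedModType R) (iota : X -> Y -> R^o) :
    set (X -> X) :=
  [set T | bounded_op T /\ exists S, preadjoints iota T S].

End BoundedOperators.

Section Products.
Context {T : Type}.

Definition prodset (A B : set (T -> T)) : set (T -> T) :=
  [set f | exists2 g, A g & exists2 h, B h & f = g \o h].

Fixpoint powset (A : set (T -> T)) (n : nat) : set (T -> T) :=
  if n is m.+1 then prodset A (powset A m) else [set idfun].

End Products.

Section Quasinilpotent.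
Context {R : realType} {X : normedModType R}.

Definition set_norm (U : set X) : \bar R :=
  ereal_sup [set (`|x|)%:E | x in U].

(* For empty [F] the set norm is [-oo], whose positive powers are 0 in the
   library, so the empty subcollection imposes no condition. *)
Definition finitely_quasinilpotent_at (C : set (X -> X)) (x : X) :=
  forall F : set (X -> X), finite_set F -> F `<=` C ->
    limn_esup (fun n : nat =>
      (set_norm [set T x | T in powset F n] `^ (n%:R^-1))%E) = 0%E.

End Quasinilpotent.

Section PositiveOperators.
Context {R : realType} {X : banachLatticeType R}.

Definition positive_op : set (X -> X) :=
  [set T | bounded_op T /\ T @` @positive_cone R X `<=` @positive_cone R X].

Definition positive_dual : set (X -> R^o) :=
  [set f | dual f /\ forall x, positive_cone x -> (0 : R) <= f x].

Definition le_op (S T : X -> X) := positive_op (T \- S).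

Definition super_right_commutant (C : set (X -> X)) : set (X -> X) :=
  [set S | positive_op S /\ forall T, C T -> le_op (T \o S) (S \o T)].

Definition dominated_ops (C : set (X -> X)) : set (X -> X) :=
  [set D | positive_op D /\
    exists (k : nat) (T S : 'I_k -> X -> X),
      [/\ (1 <= k)%N,
          forall i, super_right_commutant C (T i),
          forall i, exists2 n : nat, (1 <= n)%N & powset C n (S i)
        & le_op D (fun x => \sum_(i < k) (T i \o S i) x)]].

Definition adjoint_dominated_ops (Y : normedModType R) (iota : X -> Y -> R^o)
    (C : set (X -> X)) : set (X -> X) :=
  dominated_ops C `&` adjoint_op iota.

End PositiveOperators.

(* Main.v *)
Require Import Defs.
From HB Require Import structures.
From mathcomp Require Import all_boot all_order all_algebra.
From mathcomp Require Import all_classical all_reals all_analysis.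
From mathcomp Require Import ring lra.
Import Order.TTheory GRing.Theory Num.Theory numFieldNormedType.Exports.

(** The functional comes from a weak-star limit and the vector from convexity
and order. One limit cannot provide both: the order of [X] is not tied to [Y],
so a weak-star limit of positive vectors need not be positive.

Let [U] be the set of the [z] between 0 and [x0] with [`|x0 - z| <= r], where
[0 < r < `|x0|]. For finitely many dominated operators some [z] in [U] has
[`|pospart (x0 - T z)| > r] for each of them. Otherwise iterating
[z |-> T z \m x0], with a suitable [T] at each step, would stay in [U], hence
away from 0; but the iterates lie below products of dominated operators applied
to [x0], which decay by finite quasinilpotence ([quasinilpotent_fip]). So these
conditions generate a filter; let [z] be the weak-star limit of an ultrafilter
[G] that refines it.

If the preadjoint of [T] has essential norm [mu], then [`|T y - T z|] is at
most [d * mu + e] for [G]-almost all [y], with [d] bounding the norms of the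
[y - z] ([ess_bounded_wlim]). Hence [`|pospart (x0 - T z)| + d * mu >= r]: the
sublinear function [v |-> inf (`|pospart (v - T z)| + mu)] is positive at [x0],
and the Hahn-Banach theorem gives a positive functional [f <> 0] with
[f (T z) <= mu] ([limit_functional]). It follows that [f (T y)] is at most
[(1 + d) * mu + e] for [G]-almost all [y] in [U].

A single positive vector has to replace these [y], which depend on [T] and [e].
For [w] in [Y] with [iota x0 w > 0] let [phi] be the positive part of
[x |-> iota x w]; it is additive and order continuous on the positive cone. The
sets of admissible [y] are convex and any finitely many of them meet. Enlarge
them to a maximal such family: it has members on which [phi] of the modulus of
[y - y'] is arbitrarily small ([small_diameter]). Taking the infimum of a
sequence chosen in such members gives [x >= 0], [x <> 0], such that every set
of the family contains vectors above [x - W m], where [W m] decreases to 0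
([order_selection]). Decreasing to 0 entails weak-star convergence, so that
[f (T (W m))] is small up to a multiple of [mu], and [f (T x) <= k * mu] with
[k] independent of [T]. The functional [k^-1 * f] is the required one.

Order continuity of [phi] rests on the fact that in a dual Banach lattice a
bounded increasing net has a supremum, to which it converges weak-star
([directed_supremum]). The positive cone not being weak-star closed, this is
derived from the lower semicontinuity of the norm, by means of
[norm_add_modulus], which bounds the norm of [h + modulus p] by the norms of
the [c + p] with [modulus c <= h]. *)

Set Implicit Arguments.
Unset Strict Implicit.
Unset Printing Implicit Defensive.

Local Open Scope classical_set_scope.
Local Open Scope ring_scope.

(** * Identities between vectors *)

(** The square-zero extension of [R] by [V]: a commutative ring in which vectors
embed additively and scaling becomes multiplication, so that [ring] decides
identities between linear combinations of vectors. *)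
Definition sqzero (R : comNzRingType) (V : lmodType R) : Type := (R * V)%type.

Section SquareZero.
Context {R : comNzRingType} {V : lmodType R}.

HB.instance Definition _ := GRing.Zmodule.on (sqzero V).

Definition sqzero_mul (p q : sqzero V) : sqzero V :=
  (p.1 * q.1, p.1 *: q.2 + q.1 *: p.2).

Fact sqzero_mulA : associative sqzero_mul.
Proof.
move=> [a u] [b v] [c w]; congr pair => /=; first by rewrite mulrA.
by rewrite !scalerDr !scalerA addrA (mulrC c a) (mulrC c b).
Qed.

Fact sqzero_mulC : commutative sqzero_mul.
Proof. by move=> [a u] [b v]; congr pair => /=; rewrite ?(mulrC a) ?(addrC (a *: v)). Qed.

Fact sqzero_mul1 : left_id ((1, 0) : sqzero V) sqzero_mul.
Proof. by move=> [a u]; rewrite /sqzero_mul /= mul1r scale1r scaler0 addr0. Qed.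

Fact sqzero_mulD : left_distributive sqzero_mul +%R.
Proof.
move=> [a u] [b v] [c w]; congr pair => /=; first by rewrite mulrDl.
by rewrite scalerDl scalerDr addrACA.
Qed.

Fact sqzero_1_neq0 : ((1, 0) : sqzero V) != 0.
Proof. by apply/eqP => -[] /eqP; rewrite oner_eq0. Qed.

HB.instance Definition _ := GRing.Zmodule_isComNzRing.Build (sqzero V)
  sqzero_mulA sqzero_mulC sqzero_mul1 sqzero_mulD sqzero_1_neq0.

Definition sqv (u : V) : sqzero V := (0, u).
Definition sqs (a : R) : sqzero V := (a, 0).

Lemma sqv_inj : injective sqv. Proof. by move=> u v []. Qed.

Fact sqv_is_additive : zmod_morphism sqv.
Proof. by move=> u v; congr pair; rewrite /= subr0. Qed.
HB.instance Definition _ := GRing.isZmodMorphism.Build V (sqzero V) sqv sqv_is_additive.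

Fact sqs_is_additive : zmod_morphism sqs.
Proof. by move=> u v; congr pair; rewrite /= subr0. Qed.
HB.instance Definition _ := GRing.isZmodMorphism.Build R (sqzero V) sqs sqs_is_additive.

Fact sqs_is_multiplicative : monoid_morphism sqs.
Proof. by split=> // a b; congr pair; rewrite /= !scaler0 addr0. Qed.
HB.instance Definition _ :=
  GRing.isMonoidMorphism.Build R (sqzero V) sqs sqs_is_multiplicative.

Lemma sqvZ a u : sqv (a *: u) = sqs a * sqv u.
Proof. by congr pair; rewrite /= ?mulr0 // scaler0 addr0. Qed.

Lemma sqv0 : sqv 0 = 0. Proof. exact: raddf0. Qed.
Lemma sqvD u v : sqv (u + v) = sqv u + sqv v. Proof. exact: raddfD. Qed.
Lemma sqvN u : sqv (- u) = - sqv u. Proof. exact: raddfN. Qed.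
Lemma sqvMn u n : sqv (u *+ n) = sqv u *+ n. Proof. exact: raddfMn. Qed.
End SquareZero.

Ltac lmod := apply: sqv_inj; rewrite ?(sqvD, sqvN, sqvZ, sqv0, sqvMn);
  rewrite ?(rmorphD, rmorphN, rmorphM, rmorph1, rmorph0); ring.

(** * Banach lattices *)

Notation "x <=: y" := (bl_le x y) (at level 70, no associativity).
Notation "x \j y" := (bl_join x y) (at level 45, left associativity).
Notation "x \m y" := (bl_meet x y) (at level 45, left associativity).
Notation pospart x := (x \j 0).
Notation modulus x := (x \j (- x)).

Section VectorLattice.
Context {R : realType} {X : banachLatticeType R}.
Implicit Types (x y z u v w h p q : X) (a b : R).

Lemma ble_refl x : x <=: x. Proof. exact: bl_le_refl. Qed.
Hint Resolve ble_refl : core.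

Lemma ble_trans y x z : x <=: y -> y <=: z -> x <=: z.
Proof. exact: bl_le_trans. Qed.

Lemma ble_anti x y : x <=: y -> y <=: x -> x = y.
Proof. by move=> xy yx; apply: bl_le_anti; rewrite xy yx. Qed.

Lemma ble_sub0 x y : (x <=: y) = (0 <=: y - x).
Proof.
apply/idP/idP => [xy|xy]; first by have := @bl_leD2r _ _ _ _ (- x) xy; rewrite subrr.
by have := @bl_leD2r _ _ _ _ x xy; rewrite add0r subrK.
Qed.

(** Together with its variants below, reduces a linear consequence of known
inequalities to an identity that [lmod] proves. *)
Lemma ble_lin x y u v : u <=: v -> y - x = v - u -> x <=: y.
Proof. by rewrite [u <=: v]ble_sub0 [x <=: y]ble_sub0 => uv ->. Qed.

Lemma bleD x y u v : x <=: y -> u <=: v -> x + u <=: y + v.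
Proof.
move=> xy uv; apply: (@ble_trans (y + u)); first exact: bl_leD2r.
by rewrite ![y + _]addrC; exact: bl_leD2r.
Qed.

Lemma ble_lin2 x y u v u' v' : u <=: v -> u' <=: v' ->
  y - x = v - u + (v' - u') -> x <=: y.
Proof. by move=> uv uv' e; apply: (ble_lin (bleD uv uv') _); rewrite e; lmod. Qed.

Lemma ble_lin3 x y u v u' v' u2 v2 : u <=: v -> u' <=: v' -> u2 <=: v2 ->
  y - x = v - u + (v' - u') + (v2 - u2) -> x <=: y.
Proof.
by move=> uv uv' uv2 e; apply: (ble_lin2 (bleD uv uv') uv2 _); rewrite e; lmod.
Qed.

Lemma bleN x y : x <=: y -> - y <=: - x.
Proof. by move=> xy; apply: (ble_lin xy _); lmod. Qed.

Lemma bleZ a x y : 0 <= a -> x <=: y -> a *: x <=: a *: y.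
Proof.
by rewrite [x <=: y]ble_sub0 [a *: x <=: _]ble_sub0 -scalerBr; exact: bl_scale_ge0.
Qed.

Lemma bleMn x y n : x <=: y -> x *+ n <=: y *+ n.
Proof.
by move=> xy; elim: n => [|n IH]; rewrite ?mulr0n // !mulrS; exact: bleD.
Qed.

Lemma bleZl a b x : a <= b -> 0 <=: x -> a *: x <=: b *: x.
Proof.
move=> ab x0; rewrite ble_sub0 -scalerBl; apply: bl_scale_ge0 => //.
by rewrite subr_ge0.
Qed.

Lemma bleZI a x y : 0 < a -> a *: x <=: a *: y -> x <=: y.
Proof.
move=> a0 /(bleZ (ltW (_ : 0 < a^-1))); rewrite invr_gt0 !scalerA mulVf ?gt_eqF//.
by rewrite !scale1r; apply.
Qed.

Lemma bleD_ge0 x y : 0 <=: x -> 0 <=: y -> 0 <=: x + y.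
Proof. by move=> x0 y0; rewrite -[0]addr0; exact: bleD. Qed.

Lemma ble_joinl x y : x <=: x \j y.
Proof. by have := ble_refl (x \j y); rewrite bl_joinP => /andP[]. Qed.

Lemma ble_joinr x y : y <=: x \j y.
Proof. by have := ble_refl (x \j y); rewrite bl_joinP => /andP[]. Qed.

Lemma join_ble x y z : x <=: z -> y <=: z -> x \j y <=: z.
Proof. by rewrite bl_joinP => -> ->. Qed.

Lemma ble_meetl x y : x \m y <=: x.
Proof. by have := ble_refl (x \m y); rewrite bl_meetP => /andP[]. Qed.

Lemma ble_meetr x y : x \m y <=: y.
Proof. by have := ble_refl (x \m y); rewrite bl_meetP => /andP[]. Qed.

Lemma meet_ble x y z : z <=: x -> z <=: y -> z <=: x \m y.
Proof. by rewrite bl_meetP => -> ->. Qed.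

Lemma ble_meet2 x y x' y' : x <=: x' -> y <=: y' -> x \m y <=: x' \m y'.
Proof.
move=> xx' yy'; apply: meet_ble; [exact: ble_trans (ble_meetl _ _) _|].
exact: ble_trans (ble_meetr _ _) _.
Qed.

Lemma ble_join2 x y x' y' : x <=: x' -> y <=: y' -> x \j y <=: x' \j y'.
Proof.
move=> xx' yy'; apply: join_ble; [exact: ble_trans _ (ble_joinl _ _)|].
exact: ble_trans _ (ble_joinr _ _).
Qed.

Lemma bl_meetC x y : x \m y = y \m x.
Proof.
by apply: ble_anti; apply: meet_ble; rewrite ?ble_meetr ?ble_meetl.
Qed.

Lemma join_idl x y : y <=: x -> x \j y = x.
Proof. by move=> yx; apply: ble_anti; [apply: join_ble|exact: ble_joinl]. Qed.

Lemma meet_idl x y : x <=: y -> x \m y = x.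
Proof. by move=> yx; apply: ble_anti; [exact: ble_meetl|apply: meet_ble]. Qed.

Lemma joinDr x y z : (x \j y) + z = (x + z) \j (y + z).
Proof.
apply: ble_anti; last by apply: join_ble; apply: bl_leD2r; rewrite ?ble_joinl ?ble_joinr.
have : x \j y <=: (x + z) \j (y + z) - z.
  apply: join_ble; first by apply: (ble_lin (ble_joinl (x + z) (y + z)) _); lmod.
  by apply: (ble_lin (ble_joinr (x + z) (y + z)) _); lmod.
by move=> e; apply: (ble_lin e _); lmod.
Qed.

Lemma meetDr x y z : (x \m y) + z = (x + z) \m (y + z).
Proof.
apply: ble_anti; first by apply: meet_ble; apply: bl_leD2r; rewrite ?ble_meetl ?ble_meetr.
have : (x + z) \m (y + z) - z <=: x \m y.
  apply: meet_ble; first by apply: (ble_lin (ble_meetl (x + z) (y + z)) _); lmod.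
  by apply: (ble_lin (ble_meetr (x + z) (y + z)) _); lmod.
by move=> e; apply: (ble_lin e _); lmod.
Qed.

Lemma oppr_join x y : - (x \j y) = (- x) \m (- y).
Proof.
apply: ble_anti; first by apply: meet_ble; apply: bleN; rewrite ?ble_joinl ?ble_joinr.
rewrite -[X in X <=: _]opprK; apply: bleN; apply: join_ble.
  by rewrite -[X in X <=: _]opprK; apply: bleN; exact: ble_meetl.
by rewrite -[X in X <=: _]opprK; apply: bleN; exact: ble_meetr.
Qed.

Lemma join_add_meet x y : x \j y + x \m y = x + y.
Proof.
suff -> : x \m y = x + y - x \j y by lmod.
rewrite oppr_join addrC meetDr bl_meetC; congr bl_meet; lmod.
Qed.

Lemma meetE x y : x \m y = x - pospart (x - y).
Proof.
have := joinDr (x - y) 0 y; rewrite subrK add0r => e.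
by rewrite -[LHS](addKr (x \j y)) join_add_meet -e; lmod.
Qed.

Lemma pospart_ge0 x : 0 <=: pospart x. Proof. exact: ble_joinr. Qed.
Lemma ble_pospart x : x <=: pospart x. Proof. exact: ble_joinl. Qed.
Hint Resolve pospart_ge0 ble_pospart : core.

Lemma pospart_idl x : 0 <=: x -> pospart x = x.
Proof. exact: join_idl. Qed.

Lemma pospart_mono x y : x <=: y -> pospart x <=: pospart y.
Proof. by move=> xy; apply: ble_join2. Qed.

Lemma pospartB x : pospart x - pospart (- x) = x.
Proof.
have := joinDr (- x) 0 x; rewrite addNr add0r => e.
apply/eqP; rewrite subr_eq addrC e; apply/eqP.
by apply: ble_anti; apply: join_ble; rewrite ?ble_joinl ?ble_joinr.
Qed.

Lemma pospart_meet x : pospart x \m pospart (- x) = 0.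
Proof.
rewrite meetE pospartB; exact: subrr.
Qed.

Lemma modulusE x : modulus x = pospart x + pospart (- x).
Proof.
have := pospartB x => /eqP; rewrite subr_eq => /eqP e.
have := join_add_meet (pospart x) (pospart (- x)); rewrite pospart_meet addr0 => <-.
apply: ble_anti.
  apply: join_ble; first exact: ble_trans (ble_joinl x 0) (ble_joinl _ _).
  exact: ble_trans (ble_joinl (- x) 0) (ble_joinr _ _).
have m0 : 0 <=: modulus x.
  apply: (@bleZI 2) => //; rewrite scaler0.
  apply: (ble_lin2 (ble_joinl x (- x)) (ble_joinr x (- x)) _); lmod.
apply: join_ble; apply: join_ble => //; [exact: ble_joinl|exact: ble_joinr].
Qed.

Lemma modulus_ge0 x : 0 <=: modulus x.
Proof. by rewrite modulusE; apply: bleD_ge0. Qed.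
Hint Resolve modulus_ge0 : core.

Lemma ble_modulus x : x <=: modulus x. Proof. exact: ble_joinl. Qed.
Lemma bleN_modulus x : - x <=: modulus x. Proof. exact: ble_joinr. Qed.
Hint Resolve ble_modulus bleN_modulus : core.

Lemma modulus_id x : 0 <=: x -> modulus x = x.
Proof. by move=> xge; apply: join_idl; apply: (ble_lin2 xge xge _); lmod. Qed.

Lemma modulusN x : modulus (- x) = modulus x.
Proof. by rewrite !modulusE opprK addrC. Qed.

Lemma modulus_ble x y : x <=: y -> - x <=: y -> modulus x <=: y.
Proof. exact: join_ble. Qed.

Lemma pospart_ble_modulus x : pospart x <=: modulus x.
Proof. by apply: join_ble. Qed.

Lemma add_modulus x : x + modulus x = pospart x *+ 2.
Proof. by rewrite modulusE -[in X in X + _](pospartB x); lmod. Qed.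

Lemma meet_ge0 x y : 0 <=: x -> 0 <=: y -> 0 <=: x \m y.
Proof. exact: meet_ble. Qed.

Lemma modulusB x y : modulus (x - y) = x + y - (x \m y) *+ 2.
Proof.
rewrite meetE; have := add_modulus (x - y).
move/(congr1 (fun w => w - (x - y))); rewrite addrC addKr => ->; lmod.
Qed.

Lemma meetDl_le x y z : 0 <=: x -> 0 <=: y -> 0 <=: z ->
  (x + y) \m z <=: x \m z + y \m z.
Proof.
move=> xge yge zge.
have h1 : (x + y) \m z - y \m z <=: z.
  apply: (ble_lin2 (ble_meetr (x + y) z) (meet_ge0 yge zge) _); lmod.
have h2 : (x + y) \m z <=: x + y \m z.
  rewrite [x + y \m z]addrC meetDr; apply: ble_meet2; first by rewrite addrC.
  by apply: (ble_lin xge _); lmod.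
have h3 : (x + y) \m z - y \m z <=: x \m z.
  by apply: meet_ble => //; apply: (ble_lin h2 _); lmod.
by apply: (ble_lin h3 _); lmod.
Qed.

(** The distributive law. As [t \m z = t + z - t \j z], it reduces to an
inequality between joins. *)
Lemma joinI_le x y z : (x \j y) \m z <=: (x \m z) \j (y \m z).
Proof.
set w := (x \m z) \j (y \m z).
have h t : t \m z <=: w -> t <=: x \j y -> t <=: w - z + (x \j y) \j z.
  move=> tw txy; have tz : t \j z <=: (x \j y) \j z by apply: ble_join2.
  by apply: (ble_lin2 tw tz _); rewrite -[t \j z](addrK (t \m z)) join_add_meet; lmod.
have hx := h x (ble_joinl _ _) (ble_joinl _ _).
have hy := h y (ble_joinr _ _) (ble_joinr _ _).
have hxy := join_ble hx hy.
apply: (ble_lin hxy _).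
rewrite -[(x \j y) \m z](addKr ((x \j y) \j z)) join_add_meet; lmod.
Qed.

Lemma riesz_decomp t x y : 0 <=: t -> 0 <=: x -> 0 <=: y -> t <=: x + y ->
  [/\ 0 <=: t \m x, t \m x <=: x, 0 <=: t - t \m x & t - t \m x <=: y].
Proof.
move=> tge xge yge txy; split; [exact: meet_ge0|exact: ble_meetr| |].
  by rewrite -ble_sub0; exact: ble_meetl.
rewrite meetE opprB addrC subrK; apply: join_ble => //.
by apply: (ble_lin txy _); lmod.
Qed.

Lemma meetB_le x y z : y <=: z -> x \m z - x \m y <=: z - y.
Proof.
move=> yz; have : x \m z - (z - y) <=: x \m y.
  rewrite meetDr; apply: ble_meet2; first by apply: (ble_lin yz _); lmod.
  by apply: (ble_lin (ble_refl 0) _); lmod.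
by move=> e; apply: (ble_lin e _); lmod.
Qed.

Lemma norm_modulus x : `|modulus x| = `|x|.
Proof.
by apply/eqP; rewrite eq_le; apply/andP; split; apply: bl_norm_le;
  rewrite (modulus_id (modulus_ge0 x)).
Qed.

Lemma norm_mono x y : 0 <=: x -> x <=: y -> `|x| <= `|y|.
Proof.
move=> xge xy; apply: bl_norm_le; rewrite !modulus_id //.
exact: ble_trans xy.
Qed.

Lemma norm_le_modulus x y : modulus x <=: y -> `|x| <= `|y|.
Proof. by move=> xy; rewrite -norm_modulus; apply: norm_mono. Qed.

Lemma norm_pospart x : `|pospart x| <= `|x|.
Proof. rewrite -[`|x|]norm_modulus; apply: norm_mono => //; exact: pospart_ble_modulus. Qed.

Lemma le_of_natmul (A r B : R) : (forall n : nat, n%:R * A <= n%:R * r + B) -> A <= r.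
Proof.
move=> h; rewrite leNgt; apply/negP => rA.
have Ar : 0 < A - r by rewrite subr_gt0.
have := archi_boundP (normr_ge0 (B / (A - r))); set n := (X in X%:R) => hn.
have : B / (A - r) < n%:R by exact: le_lt_trans (ler_norm _) hn.
by rewrite ltr_pdivrMr// mulrBr; have := h n; lra.
Qed.

Lemma meetZ_le_disjoint a x y : 1 <= a -> 0 <=: x -> 0 <=: y -> x \m y = 0 ->
  x \m (a *: y) = 0.
Proof.
move=> a1 xge yge xy; have age : 0 < a by apply: lt_le_trans a1.
have mge : 0 <=: x \m (a *: y).
  by apply: meet_ge0 => //; apply: bl_scale_ge0 => //; exact: ltW.
apply: ble_anti => //; rewrite -[X in _ <=: X](scaler0 _ a) -xy.
apply: (@bleZI a^-1); first by rewrite invr_gt0.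
rewrite scalerA mulVf ?gt_eqF// scale1r; apply: meet_ble.
  apply: ble_trans (ble_meetl x (a *: y)); rewrite -[X in _ <=: X]scale1r.
  by apply: bleZl => //; rewrite invf_le1.
have := ble_meetr x (a *: y) => /(bleZ (ltW (_ : 0 < a^-1))).
by rewrite invr_gt0 scalerA mulVf ?gt_eqF// scale1r; apply.
Qed.

(** Flipping the sign of [h] below [u], where [u] dominates the negative part of
[p] and is disjoint from its positive part, turns [h] into an element with the
sign of [p], except on the part of [h] that exceeds [u]; this part is measured
by the growth of [h \m u] when [u] is doubled. *)
Lemma sign_flip_step h p u : 0 <=: h -> pospart (- p) <=: u ->
  pospart p \m u = 0 ->
  h + modulus p <=: modulus (h - (h \m u) *+ 2 + p) +
                    (h \m (u *+ 2) - h \m u) *+ 4.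
Proof.
set q := pospart (- p); set r := pospart p; set a := h \m u.
move=> hge qu ru; set s := h - a.
have qge : 0 <=: q by exact: pospart_ge0.
have rge : 0 <=: r by exact: pospart_ge0.
have uge : 0 <=: u by exact: ble_trans qu.
have age : 0 <=: a by exact: meet_ge0.
have sge : 0 <=: s by rewrite -ble_sub0; exact: ble_meetl.
have su : s \m u <=: h \m (u *+ 2) - a.
  have : s \m u + a <=: h \m (u *+ 2).
    apply: meet_ble.
      by apply: (ble_lin (ble_meetl s u) _); rewrite /s; lmod.
    by apply: (ble_lin2 (ble_meetr s u) (ble_meetr h u) _); rewrite /a; lmod.
  by move=> e; apply: (ble_lin e _); lmod.
have rq0 : r \m q <=: 0 by rewrite -ru; apply: ble_meet2.
have ra0 : r \m a <=: 0 by rewrite -ru; apply: ble_meet2 => //; exact: ble_meetr.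
have m1 : (s + r) \m (a + q) <=: (s \m u) *+ 2.
  apply: ble_trans (meetDl_le sge rge (bleD_ge0 age qge)) _.
  rewrite ![_ \m (a + q)]bl_meetC.
  have e1 : (a + q) \m s <=: s \m u + s \m u.
    apply: ble_trans (meetDl_le age qge sge) _; rewrite ![_ \m s]bl_meetC.
    by apply: bleD; apply: ble_meet2 => //; exact: ble_meetr.
  have e2 : (a + q) \m r <=: 0 + 0.
    apply: ble_trans (meetDl_le age qge rge) _; rewrite ![_ \m r]bl_meetC.
    exact: bleD.
  by apply: (ble_lin2 e1 e2 _); lmod.
have -> : h - a *+ 2 + p = (s + r) - (a + q).
  by rewrite -[p in LHS](pospartB p) -/r -/q /s; lmod.
rewrite modulusB modulusE -/r -/q.
by apply: (ble_lin3 m1 m1 (bleD (bleD su su) (bleD su su)) _); rewrite /s; lmod.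
Qed.

(** Among functions, [c] equal to [h] times the sign of [p] satisfies
[modulus (c + p) = h + modulus p]. A vector lattice need not contain this [c].
The elements [h - 2 (h \m (2 ^+ i *: q))] replace it, [q] being the negative
part of [p]: their errors telescope in [i], so that the error of the average
of the first [n] of them has norm at most [4 * `|h| / n]. *)
Lemma norm_add_modulus h p (r : R) : 0 <=: h ->
  (forall c, modulus c <=: h -> `|c + p| <= r) -> `|h + modulus p| <= r.
Proof.
move=> hge hr; set q := pospart (- p).
have qge : 0 <=: q by exact: pospart_ge0.
pose a i := h \m ((2 ^+ i) *: q).
have uge i : 0 <=: (2 ^+ i) *: q by apply: bl_scale_ge0 => //; exact: exprn_ge0.
have age i : 0 <=: a i by exact: meet_ge0.
have claim n : exists V, `|V| <= n%:R * r /\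
    n%:R *: (h + modulus p) <=: V + (a n) *+ 4.
  elim: n => [|n [V [Vr hV]]].
    exists 0; rewrite normr0 mul0r scale0r; split=> //.
    by apply: (ble_lin2 (bleD (age 0) (age 0)) (bleD (age 0) (age 0)) _); lmod.
  pose c := h - (a n) *+ 2.
  have ch : modulus c <=: h.
    apply: modulus_ble.
      by apply: (ble_lin2 (age n) (age n) _); rewrite /c; lmod.
    apply: (ble_lin2 (ble_meetl h ((2 ^+ n) *: q)) (ble_meetl h ((2 ^+ n) *: q)) _).
    by rewrite /c /a; lmod.
  exists (V + modulus (c + p)); split.
    apply: (le_trans (ler_normD _ _)); rewrite norm_modulus -[n.+1]addn1 natrD mulrDl mul1r.
    by apply: lerD => //; exact: hr.
  have st : h + modulus p <=: modulus (c + p) + (a n.+1 - a n) *+ 4.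
    have -> : a n.+1 = h \m (((2 ^+ n) *: q) *+ 2).
      by rewrite /a; congr bl_meet; rewrite exprS; lmod.
    apply: sign_flip_step => //.
      rewrite -[X in X <=: _]scale1r; apply: bleZl => //.
      by apply: exprn_ege1; rewrite ler1n.
    apply: meetZ_le_disjoint => //; first by apply: exprn_ege1; rewrite ler1n.
    exact: pospart_meet.
  by apply: (ble_lin2 hV st _); rewrite -[n.+1]addn1; lmod.
apply: (@le_of_natmul _ _ (4 * `|h|)) => n.
have [V [Vr hV]] := claim n.
have hV' : n%:R *: (h + modulus p) <=: V + h *+ 4.
  apply: ble_trans hV _; apply: bleD => //.
  by apply: bleMn; exact: ble_meetl.
have := norm_mono (@bl_scale_ge0 _ _ _ _ (ler0n R n) (bleD_ge0 hge (modulus_ge0 p))) hV'.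
rewrite normrZ ger0_norm// => /le_trans; apply.
apply: (le_trans (ler_normD _ _)); apply: lerD => //.
by rewrite -scaler_nat normrZ ger0_norm.
Qed.

Lemma double_half x : (2^-1 *: x) *+ 2 = x.
Proof. by rewrite -scaler_nat scalerA mulfV ?scale1r// pnatr_eq0. Qed.

(** At the midpoint [a], the gap in the concavity of [x |-> x \m w] controls
[modulus (x - y)] up to the distance from [a] to [w]. *)
Lemma modulus_dist_meet x y w : let a := 2^-1 *: (x + y) in
  (modulus (x - y) <=: modulus (a - w) *+ 2 +
    ((a \m w) *+ 2 - x \m w - y \m w) *+ 2 : Prop).
Proof.
set a := _ *: _ => /=; have aE : x + y = a *+ 2 by rewrite double_half.
have h1 : x \m w + y \m w <=: w + x \m y.
  rewrite -join_add_meet; apply: bleD.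
    by apply: join_ble; exact: ble_meetr.
  by apply: ble_meet2; exact: ble_meetl.
rewrite (modulusB a w) (modulusB x y) aE.
by apply: (ble_lin2 h1 h1 _); lmod.
Qed.

Lemma meet_midpoint x y w : let a := 2^-1 *: (x + y) in
  (0 <=: (a \m w) *+ 2 - x \m w - y \m w : Prop).
Proof.
set a := _ *: _ => /=; have aE : x + y = a *+ 2 by rewrite double_half.
have h1 : 2^-1 *: (x \m w + y \m w) <=: a \m w.
  apply: meet_ble; first by apply: bleZ => //; apply: bleD; exact: ble_meetl.
  rewrite -[X in _ <=: X](double_half w) scalerMnr mulr2n.
  by apply: bleZ => //; apply: bleD; exact: ble_meetr.
have := bleMn 2 h1; rewrite double_half => h2.
by apply: (ble_lin h2 _); lmod.
Qed.

(** Every number between 0 and [m * u] is within [u] of some [j * u]. In a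
vector lattice the point of the grid varies from place to place, and the
statement bounds the common lower bounds of the distances instead; grid points
are discarded one after the other by distributivity. *)
Lemma grid_ble x u v (m : nat) : 0 <=: u -> 0 <=: x -> x <=: m%:R *: u ->
  (forall j, (j <= m)%N -> v <=: modulus (x - j%:R *: u)) -> v <=: u.
Proof.
move=> uge xge am he.
have claim k : (k <= m)%N -> v <=: u \j (x - k%:R *: u).
  elim: k => [_|k IH km].
    have := he 0%N (leq0n _); rewrite scale0r subr0 modulus_id// => /ble_trans; apply.
    exact: ble_joinr.
  have e1 := IH (ltnW km); have e2 := he _ km.
  set w := x - k%:R *: u in e1 *.
  have bE : x - k.+1%:R *: u = w - u by rewrite /w -addn1; lmod.
  rewrite bE in e2 *.
  apply: (ble_trans (meet_ble e1 e2)); apply: (ble_trans (joinI_le _ _ _)).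
  apply: join_ble; first exact: ble_trans (ble_meetl _ _) (ble_joinl _ _).
  rewrite bl_meetC; apply: (ble_trans (joinI_le _ _ _)); apply: join_ble.
    exact: ble_trans (ble_meetl _ _) (ble_joinr _ _).
  apply: ble_trans (ble_joinl _ _); apply: (@bleZI 2) => //.
  apply: (ble_lin3 (ble_meetl (- (w - u)) w) (ble_meetr (- (w - u)) w) uge _); lmod.
apply: (ble_trans (claim m (leqnn m))); apply: join_ble => //.
by apply: (ble_lin2 am uge _); lmod.
Qed.
End VectorLattice.

#[local] Hint Resolve ble_refl pospart_ge0 ble_pospart modulus_ge0 ble_modulus bleN_modulus : core.

(** * Weak-star limits in a dual Banach space *)

Lemma opnorm_ub (R : realType) (V W : normedModType R) (T : V -> W) v :
  bounded_op T -> `|v| <= 1 -> `|T v| <= opnorm T.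
Proof.
move=> [_ [M hM]] v1; apply: sup_ubound; last by exists v.
exists `|M| => _ /= [w w1 <-]; apply: (le_trans (hM w)).
by apply: (le_trans (ler_wpM2r (normr_ge0 w) (ler_norm M))); rewrite ler_piMr.
Qed.

Lemma le_opnorm (R : realType) (V W : normedModType R) (T : V -> W) v :
  bounded_op T -> `|T v| <= opnorm T * `|v|.
Proof.
move=> bT; have [linT _] := bT.
have T0 : T 0 = 0 by have := linT (-1) 0 0; rewrite scaler0 addr0 scaleN1r addNr.
have [->|v0] := eqVneq v 0; first by rewrite T0 !normr0 mulr0.
have nv : 0 < `|v| by rewrite normr_gt0.
have -> : T v = `|v| *: T (`|v|^-1 *: v).
  have := linT `|v| (`|v|^-1 *: v) 0.
  by rewrite T0 !addr0 scalerA mulfV ?gt_eqF// scale1r.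
rewrite normrZ normr_id mulrC; apply: ler_wpM2r => //.
by apply: opnorm_ub => //; rewrite normrZ ger0_norm ?invr_ge0// mulVf ?gt_eqF.
Qed.

Lemma opnorm_ge0 (R : realType) (V W : normedModType R) (T : V -> W) :
  bounded_op T -> 0 <= opnorm T.
Proof. by move=> bT; apply: le_trans (opnorm_ub (v := 0) bT _); rewrite ?normr0. Qed.

Lemma opnorm_le (R : realType) (V W : normedModType R) (T : V -> W) r :
  (forall v, `|v| <= 1 -> `|T v| <= r) -> opnorm T <= r.
Proof.
move=> h; apply: sup_le_ub; first by exists `|T 0|, 0 => //=; rewrite normr0.
by move=> _ [v v1 <-]; exact: h.
Qed.

Lemma fmap_ultra (T U : Type) (f : T -> U) (G : set_system T) :
  UltraFilter G -> UltraFilter (f @ G).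
Proof.
move=> GU; split; first exact: fmap_proper_filter.
move=> H HP GH; apply/seteqP; split=> // A HA.
have [//|GA] := in_ultra_setVsetC (f @^-1` A) GU.
have [t [//]] := filter_ex (filterI HA (GH (~` A) GA)).
Qed.

Section WeakStar.
Context {R : realType} {X : banachLatticeType R} {Y : normedModType R}.
Context {iota : X -> Y -> R^o} (XY : dual_identification iota).
Implicit Types (x y z g s : X) (w : Y) (r e : R).

Lemma iota_lin a x z w : iota (a *: x + z) w = a * iota x w + iota z w :> R.
Proof. by have [lin _ _] := XY; rewrite lin. Qed.

Lemma iota_zero w : iota 0 w = 0 :> R.
Proof. by have := iota_lin (-1) 0 0 w; rewrite scaler0 addr0 mulN1r addNr. Qed.

Lemma iota_add x z w : iota (x + z) w = iota x w + iota z w :> R.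
Proof. by rewrite -[x]scale1r iota_lin mul1r scale1r. Qed.

Lemma iota_opp x w : iota (- x) w = - iota x w :> R.
Proof. by apply/eqP; rewrite -addr_eq0 -iota_add addNr iota_zero. Qed.

Lemma iota_sub x z w : iota (x - z) w = iota x w - iota z w :> R.
Proof. by rewrite iota_add iota_opp. Qed.

Lemma iota_dual x : dual (iota x).
Proof. by have [_ rg _] := XY; rewrite -rg; exists x. Qed.

Lemma iota_le x w : `|iota x w : R| <= `|x| * `|w|.
Proof. by have [_ _ nm] := XY; rewrite -nm; exact: (le_opnorm _ (iota_dual x)). Qed.

Lemma iota_norm_le x r : (forall w, `|w| <= 1 -> `|iota x w : R| <= r) -> `|x| <= r.
Proof. by have [_ _ nm] := XY; rewrite -nm; exact: opnorm_le. Qed.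

(** Weak-star convergence, expressed by the pairing because the topology that
[X] carries is that of the norm. *)
Definition wlim (G : set_system X) g :=
  forall w e, 0 < e -> G [set x | `|iota (x - g) w : R| < e].

(** Lower semicontinuity of the norm. Statements about the order enter through
the translation by [c], as the positive cone need not be weak-star closed. *)
Lemma wlim_norm_le (G : set_system X) {FG : ProperFilter G} g c r :
  wlim G g -> G [set x | `|c + x| <= r] -> `|c + g| <= r.
Proof.
move=> Gg Gr; apply: iota_norm_le => w w1; apply/ler_addgt0Pr => e e0.
have [x [/= x1 x2]] := filter_ex (filterI Gr (Gg w _ e0)).
have -> : iota (c + g) w = (iota (c + x) w - iota (x - g) w : R) :> R.
  by rewrite iota_sub !iota_add; ring.
apply: (le_trans (ler_normB _ _)); apply: lerD (ltW x2).
apply: (le_trans (iota_le _ _)); apply: le_trans x1.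
by rewrite ler_piMr.
Qed.

(** The Banach-Alaoglu theorem: along an ultrafilter the bounded numbers
[iota x w] converge for each [w], and the limit is a bounded linear functional
of [w], hence given by a vector. *)
Lemma ultra_wlim (G : set_system X) {FG : UltraFilter G} r :
  G [set x | `|x| <= r] -> exists g, wlim G g.
Proof.
move=> Gr.
have lim w : exists l : R, forall e, 0 < e -> G [set x | `|(iota x w : R) - l| < e].
  pose f x : R := iota x w.
  have fG : UltraFilter (f @ G).
    exact: fmap_ultra.
  have : G (f @^-1` `[- (r * `|w|), r * `|w|]%classic).
    apply: filterS Gr => x /= xr; rewrite in_itv /= -ler_norml /f.
    by apply: (le_trans (iota_le x w)); exact: ler_wpM2r.
  move=> /(@segment_compact _ _ _ (f @ G) _)[l [_]]; rewrite ultra_cvg_clusterE => fl.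
  exists l => e e0; move/cvgrPdist_lt : fl => /(_ _ e0); apply: filterS => x /=.
  by rewrite distrC.
have /choice[L hL] := lim.
have near3 w1 w2 w3 e : 0 < e -> exists x, [/\ `|x| <= r, `|(iota x w1 : R) - L w1| < e,
    `|(iota x w2 : R) - L w2| < e & `|(iota x w3 : R) - L w3| < e].
  move=> e0; have [x [/= ? [? [? ?]]]] := filter_ex (filterI Gr
    (filterI (hL w1 _ e0) (filterI (hL w2 _ e0) (hL w3 _ e0)))).
  by exists x.
have Lbd w : `|L w| <= r * `|w|.
  apply/ler_addgt0Pr => e e0; have [x [xr x1 _ _]] := near3 w w w e e0.
  have -> : L w = iota x w - ((iota x w : R) - L w) :> R by ring.
  apply: (le_trans (ler_normB _ _)); apply: lerD (ltW x1).
  by apply: (le_trans (iota_le _ _)); exact: ler_wpM2r.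
have Llin : linear (L : Y -> R^o).
  move=> a w1 w2; apply/eqP; rewrite -subr_eq0 -normr_le0.
  apply/ler_addgt0Pr => e e0; rewrite add0r.
  have [] := near3 w1 w2 (a *: w1 + w2) (e / (`|a| + 2)).
    by rewrite divr_gt0// ltr_wpDl.
  move=> x [_ x1 x2 x3]; have [ix _] := iota_dual x.
  have ixE : iota x (a *: w1 + w2) = a * iota x w1 + iota x w2 :> R by rewrite ix.
  have -> : L (a *: w1 + w2) - (a *: (L w1 : R^o) + L w2) =
     - ((iota x (a *: w1 + w2) : R) - L (a *: w1 + w2)) +
     (a * ((iota x w1 : R) - L w1) + ((iota x w2 : R) - L w2)) :> R.
    by rewrite ixE /GRing.scale /=; ring.
  apply: (le_trans (ler_normD _ _)); rewrite normrN.
  have h2 : `|a * ((iota x w1 : R) - L w1) + ((iota x w2 : R) - L w2)| <=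
       `|a| * (e / (`|a| + 2)) + e / (`|a| + 2).
    apply: (le_trans (ler_normD _ _)); apply: lerD; last exact: ltW.
    by rewrite normrM; apply: ler_wpM2l => //; exact: ltW.
  apply: (le_trans (lerD (ltW x3) h2)).
  have -> : e / (`|a| + 2) + (`|a| * (e / (`|a| + 2)) + e / (`|a| + 2)) =
    (`|a| + 2) * (e / (`|a| + 2)) by ring.
  by rewrite mulrC divfK// gt_eqF// ltr_wpDl.
have [_ rg _] := XY; have : dual (L : Y -> R^o).
  by split=> //; exists r.
rewrite -rg => -[g _ gL]; exists g => w e e0.
by apply: filterS (hL w e e0) => x /=; rewrite iota_sub gL.
Qed.

End WeakStar.
Arguments wlim {R X Y} iota G g.

(** * Bounded increasing nets converge to their suprema *)

Section DirectedSuprema.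
Context {R : realType} {X : banachLatticeType R} {Y : normedModType R}.
Context {iota : X -> Y -> R^o} (XY : dual_identification iota).
Implicit Types (x y z g s u v : X) (S : set X).

Definition upper_bound S u := forall x, S x -> x <=: u.
Definition is_supremum S s := upper_bound S s /\ forall u, upper_bound S u -> s <=: u.
Definition directed S := forall x y, S x -> S y -> exists z, [/\ S z, x <=: z & y <=: z].

Lemma nat_norm_bounded (A r : R) : (forall n : nat, n%:R * A <= r) -> A <= 0.
Proof. by move=> h; apply: (@le_of_natmul R _ _ r) => n; rewrite mulr0 add0r. Qed.

Lemma norm_le0 x : `|x| <= 0 -> x = 0.
Proof. by rewrite normr_le0 => /eqP. Qed.

(** Let [q x] be the positive part of [x - s], which increases with [x]. Suppose
that the norms of all the [E + (j + 1) q x] are at most [r]. Lower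
semicontinuity, applied along the tail above [x], bounds by [r] the norms of
the [c + (s - x)] with [modulus c] below a vector [B]; then [norm_add_modulus]
gives the bound [r] for [B + modulus (s - x) = E + (j + 2) q x]. So all the
multiples of [q x] are bounded, and [q x = 0]. *)
Lemma wlim_directed_upper_bound S (G : set_system X) {FG : ProperFilter G} s v :
  upper_bound S v -> (forall x, S x -> G [set z | S z /\ x <=: z]) ->
  wlim iota G s -> upper_bound S s.
Proof.
move=> Sv tailG Gs x1 Sx1.
(* [E] is large enough for the vectors [B] below to be positive. *)
pose q x := pospart (x - s); pose E := modulus s + modulus x1.
have qmono x y : x <=: y -> q x <=: q y.
  by move=> xy; apply: pospart_mono; apply: (ble_lin xy _); lmod.
pose r := `|E + q v|.
have Ege : 0 <=: E by apply: bleD_ge0.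
have qge x : 0 <=: q x by exact: pospart_ge0.
have claim (j : nat) : forall x, S x -> x1 <=: x -> `|E + j.+1%:R *: q x| <= r.
  elim: j => [|j IH] x Sx x1x.
    rewrite scale1r; apply: norm_mono; first exact: bleD_ge0.
    by apply: bleD => //; apply: qmono; exact: Sv.
  pose B := E - s + j%:R *: q x + x.
  have jq : 0 <=: j%:R *: q x by exact: bl_scale_ge0.
  have Bge : 0 <=: B.
    apply: (ble_lin3 (bleD jq x1x) (ble_modulus s) (bleN_modulus x1) _).
    by rewrite /B /E; lmod.
  have -> : E + j.+2%:R *: q x = B + modulus (s - x).
    have : modulus (s - x) = s - x + q x *+ 2.
      by rewrite /q -(add_modulus (x - s)) -(modulusN (x - s)) (opprB x s); lmod.
    by move=> ->; rewrite /B -addn2; lmod.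
  apply: norm_add_modulus => // c cB.
  have -> : c + (s - x) = (c - x) + s by lmod.
  apply: (wlim_norm_le XY Gs _) => //.
  apply: filterS (tailG _ Sx) => z /= [Sz xz].
  apply: le_trans (IH z Sz (ble_trans x1x xz)); apply: norm_le_modulus.
  have zs : z - s <=: q z by exact: ble_pospart.
  have jqz : j%:R *: q x <=: j%:R *: q z by apply: bleZ => //; exact: qmono.
  have h0 : B + (z - x) <=: E + j.+1%:R *: q z.
    by apply: (ble_lin2 zs jqz _); rewrite /B -addn1; lmod.
  apply: ble_trans h0; apply: modulus_ble.
    have cB' := ble_trans (ble_modulus c) cB.
    by apply: (ble_lin cB' _); lmod.
  have cB' := ble_trans (bleN_modulus c) cB.
  by apply: (ble_lin3 cB' xz xz _); lmod.
have q0 : q x1 = 0.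
  apply: norm_le0; apply: (@nat_norm_bounded _ r) => n.
  have := claim n x1 Sx1 (ble_refl _); apply: le_trans.
  rewrite -[n%:R]ger0_norm// -normrZ; apply: norm_mono; first exact: bl_scale_ge0.
  by apply: (ble_lin2 Ege (qge x1) _); rewrite -addn1; lmod.
have : x1 - s <=: q x1 by exact: ble_pospart.
by rewrite q0 => h; apply: (ble_lin h _); lmod.
Qed.

(** Let [n] be the positive part of [s - u]. The vector [C k.+1] is a weak-star
limit of vectors whose modulus is below [C k], so adding [n] once more does not
increase the norm; hence the multiples of [n] are bounded, and [n = 0]. *)
Lemma wlim_directed_supremum S (G : set_system X) {FG : ProperFilter G} s v :
  upper_bound S v -> (forall x, S x -> G [set z | S z /\ x <=: z]) ->
  wlim iota G s -> (exists x, S x) -> is_supremum S s.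
Proof.
move=> Sv tailG Gs [x1 Sx1].
have Ss : upper_bound S s by exact: (wlim_directed_upper_bound Sv tailG Gs).
split=> // u Su; pose n := pospart (s - u); pose m := u \m s.
have nE : s = m + n by rewrite /m bl_meetC meetE -/n; lmod.
have nge : 0 <=: n by exact: pospart_ge0.
pose C (k : nat) := (m - x1) + k%:R *: n.
have step k : `|C k.+1| <= `|C k|.
  have -> : C k.+1 = (C k - m) + s by rewrite nE /C -addn1; lmod.
  apply: (wlim_norm_le XY Gs _) => //.
  apply: filterS (tailG _ Sx1) => z /= [Sz x1z]; apply: norm_le_modulus.
  have zm : z <=: m by exact: (meet_ble (Su _ Sz) (Ss _ Sz)).
  have kn : 0 <=: k%:R *: n by exact: bl_scale_ge0.
  apply: modulus_ble; first by apply: (ble_lin zm _); lmod.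
  by apply: (ble_lin3 x1z (bleD kn kn) (ble_trans x1z zm) _); rewrite /C; lmod.
have bd k : `|C k| <= `|C 0%N| by elim: k => // k IH; exact: le_trans IH.
have n0 : n = 0.
  apply: norm_le0; apply: (@nat_norm_bounded _ `|C 0%N|) => k.
  apply: le_trans (bd k); rewrite -[k%:R]ger0_norm// -normrZ; apply: norm_mono.
    exact: bl_scale_ge0.
  have x1m : x1 <=: m by exact: (meet_ble (Su _ Sx1) (Ss _ Sx1)).
  by apply: (ble_lin x1m _); rewrite /C; lmod.
have : s - u <=: n by exact: ble_pospart.
by rewrite n0 => h; apply: (ble_lin h _); lmod.
Qed.

Lemma directed_supremum S v : (exists x, S x) -> directed S -> upper_bound S v ->
  exists s, is_supremum S s /\ exists G : set_system X,
    [/\ ProperFilter G, forall x, S x -> G [set z | S z /\ x <=: z] & wlim iota G s].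
Proof.
move=> S0 dirS Sv.
pose tail x := [set z | S z /\ x <=: z].
pose F := filter_from S tail.
have FF : ProperFilter F.
  apply: filter_from_proper; last by move=> x Sx; exists x.
  apply: filter_from_filter => // x y Sx Sy.
  have [z [Sz xz yz]] := dirS _ _ Sx Sy; exists z => // t [St zt].
  by split; split=> //; [exact: ble_trans zt|exact: ble_trans zt].
have [G [GU FG]] := ultraFilterLemma FF.
have tailG x : S x -> G (tail x) by move=> Sx; apply: FG; exists x => //; exact: subset_refl.
have [x1 Sx1] := S0.
have Gr : G [set x | `|x| <= `|modulus x1 + modulus v|].
  apply: filterS (tailG _ Sx1) => z [Sz x1z] /=; apply: norm_le_modulus.
  have zv := Sv _ Sz; apply: modulus_ble.
    by apply: (ble_lin3 zv (ble_modulus v) (modulus_ge0 x1) _); lmod.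
  by apply: (ble_lin3 x1z (bleN_modulus x1) (modulus_ge0 v) _); lmod.
have [s Gs] := ultra_wlim XY Gr.
exists s; split; last by exists G; split=> //; exact: ultra_proper.
exact: (wlim_directed_supremum Sv tailG Gs S0).
Qed.

End DirectedSuprema.

(** * Order continuous positive functionals *)

Section PositivePart.
Context {R : realType} {X : banachLatticeType R} {Y : normedModType R}.
Context {iota : X -> Y -> R^o} (XY : dual_identification iota).
Implicit Types (x y z t s : X) (S : set X).

(** The positive part of the functional [x |-> iota x w], by the
Riesz-Kantorovich formula. *)
Definition predual_pos (w : Y) x : R :=
  sup [set (iota t w : R) | t in [set t | 0 <=: t /\ t <=: x]].

Section fixw.
Context (w : Y).
Notation phi := (predual_pos w).

Let phi_has_sup x : 0 <=: x ->
  has_sup [set (iota t w : R) | t in [set t | 0 <=: t /\ t <=: x]].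
Proof.
move=> xge; split; first by exists (iota 0 w : R), 0.
exists (`|x| * `|w|) => _ [t [tge tx] <-].
apply: (le_trans (ler_norm _)); apply: (le_trans (iota_le XY _ _)).
by apply: ler_wpM2r => //; exact: norm_mono.
Qed.

Lemma predual_pos_ge t x : 0 <=: t -> t <=: x -> (iota t w : R) <= phi x.
Proof.
move=> tge tx; apply: sup_upper_bound; first by apply: phi_has_sup; exact: ble_trans tx.
by exists t.
Qed.

Lemma predual_pos_le x r : 0 <=: x ->
  (forall t, 0 <=: t -> t <=: x -> (iota t w : R) <= r) -> phi x <= r.
Proof.
move=> xge h; apply: ge_sup; first by have [] := phi_has_sup xge.
by move=> _ [t [tge tx] <-]; exact: h.
Qed.

Lemma predual_pos_ge0 x : 0 <=: x -> 0 <= phi x.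
Proof. by move=> xge; have := predual_pos_ge (ble_refl 0) xge; rewrite (iota_zero XY). Qed.

Lemma predual_pos_norm x : 0 <=: x -> phi x <= `|x| * `|w|.
Proof.
move=> xge; apply: predual_pos_le => // t tge tx.
apply: (le_trans (ler_norm _)); apply: (le_trans (iota_le XY _ _)).
by apply: ler_wpM2r => //; exact: norm_mono.
Qed.

Lemma predual_posD x y : 0 <=: x -> 0 <=: y -> phi (x + y) = phi x + phi y.
Proof.
move=> xge yge; apply/eqP; rewrite eq_le; apply/andP; split.
  apply: predual_pos_le; first exact: bleD_ge0.
  move=> t tge txy; have [d1 d2 d3 d4] := riesz_decomp tge xge yge txy.
  have -> : iota t w = (iota (t \m x) w + iota (t - t \m x) w : R) :> R.
    by rewrite (iota_sub XY); ring.
  by apply: lerD; exact: predual_pos_ge.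
rewrite -lerBrDr; apply: predual_pos_le => // t tge tx.
rewrite lerBrDr -lerBrDl; apply: predual_pos_le => // u uge uy.
rewrite lerBrDl -(iota_add XY); apply: predual_pos_ge; first exact: bleD_ge0.
exact: bleD.
Qed.

(** If [S] increases to [s] and [0 <= t <= s], then the [t \m x], [x] in [S],
increase to [t]; they converge to it weak-star, and [iota _ w] is weak-star
continuous. *)
Lemma predual_pos_sup S s r : (exists x, S x) -> directed S -> is_supremum S s ->
  (forall x, S x -> 0 <=: x) -> (forall x, S x -> phi x <= r) -> phi s <= r.
Proof.
move=> [x1 Sx1] dirS [Ss sS] Sge Sr.
have sge : 0 <=: s by exact: ble_trans (Sge _ Sx1) (Ss _ Sx1).
apply: predual_pos_le => // t tge ts.
pose St := [set t \m x | x in S].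
have St0 : exists x, St x by exists (t \m x1), x1.
have dirSt : directed St.
  move=> _ _ [x Sx <-] [y Sy <-]; have [z [Sz xz yz]] := dirS _ _ Sx Sy.
  by exists (t \m z); split; [exists z|exact: ble_meet2|exact: ble_meet2].
have Stt : upper_bound St t by move=> _ [x _ <-]; exact: ble_meetl.
have [s' [[Ss' s'S] [G [GF tailG Gs]]]] := directed_supremum XY St0 dirSt Stt.
have s't : s' = t.
  apply: ble_anti; first exact: s'S.
  suff : s <=: s' + s - t by move=> h; apply: (ble_lin h _); lmod.
  apply: sS => x Sx; have := Ss' _ (ex_intro2 _ _ x Sx erefl) => h1.
  have h2 := meetB_le t (Ss _ Sx).
  by apply: (ble_lin2 h1 h2 _); rewrite (meet_idl ts); lmod.
apply/ler_addgt0Pr => e e0.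
have Stx1 : St (t \m x1) by exists x1.
have [_ [[[x Sx <-] _] /=]] := filter_ex (filterI (tailG _ Stx1) (Gs w e e0)).
rewrite s't (iota_sub XY) ltr_norml => /andP[h _].
have h' : (iota (t \m x) w : R) <= r.
  apply: le_trans (Sr _ Sx); apply: predual_pos_ge; last exact: ble_meetr.
  by apply: meet_ge0 => //; exact: Sge.
lra.
Qed.
End fixw.
End PositivePart.

(** * Maximal families of convex sets *)

Section ConvexFamilies.
Context {R : realType} {X : lmodType R}.

Definition midconvex (A : set X) := forall x y, A x -> A y -> A (2^-1 *: (x + y)).

Definition convex_base (F : set (set X)) :=
  (forall A, F A -> midconvex A /\ A !=set0) /\
  (forall A B, F A -> F B -> F (A `&` B)).

Lemma maximal_convex_base F0 : convex_base F0 ->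
  exists F, [/\ F0 `<=` F, convex_base F &
    forall F', convex_base F' -> F `<=` F' -> F' `<=` F].
Proof.
move=> F0b; pose P := [set F | convex_base (F `|` F0)].
have [] := @Zorn_bigcup _ P.
  move=> C CP totC; split.
    move=> A [[F CF FA]|F0A]; last exact: F0b.1.
    by apply: (CP _ CF).1; left.
  move=> A B [[F CF FA]|F0A] [[F' CF' FB]|F0B].
  - wlog FF' : A B F F' CF CF' FA FB / F `<=` F'.
      move=> wl; have [FF'|FF'] := totC _ _ CF CF'; first exact: (wl A B F F').
      by rewrite setIC; exact: (wl B A F' F).
    have [|?] := (CP _ CF').2 A B (or_introl (FF' _ FA)) (or_introl FB).
      by left; exists F'.
    by right.
  - have [|?] := (CP _ CF).2 A B (or_introl FA) (or_intror F0B); last by right.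
    by left; exists F.
  - have [|?] := (CP _ CF').2 A B (or_intror F0A) (or_introl FB); last by right.
    by left; exists F'.
  - by right; exact: F0b.2.
move=> F [PF maxF]; exists (F `|` F0); split=> [A ?||]; [by right|exact: PF|].
move=> F' bF' FF' A F'A; left; apply: contrapT => nFA.
apply: (maxF F').
  split; first by move=> B FB; apply: FF'; left.
  by move=> /(_ _ F'A).
rewrite /P /= (_ : F' `|` F0 = F')//; apply/seteqP; split=> [B [//|F0B]|B ?]; last by left.
by apply: FF'; right.
Qed.

(** Let [l] be the infimum, over the members of [F], of the supremum of [a]. The
slice [l - e <= a] is convex, since [a] is concave, and it meets every member,
so that it belongs to [F] by maximality. On its intersection with a member where
the supremum of [a] is almost [l], the oscillation of [a] is small. *)
Lemma slice_oscillation (F : set (set X)) (B : set X) (a : X -> R) (M e : R) :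
  convex_base F -> (forall F', convex_base F' -> F `<=` F' -> F' `<=` F) ->
  F B -> (forall x, B x -> 0 <= a x <= M) ->
  (forall x y, B x -> B y -> a x + a y <= 2 * a (2^-1 *: (x + y))) ->
  0 < e -> exists G l, [/\ F G, G `<=` B & forall x, G x -> l - e <= a x <= l + e].
Proof.
move=> bF maxF FB aM conc e0.
pose h G := sup [set a x | x in G `&` B].
have hsup G : F G -> has_sup [set a x | x in G `&` B].
  move=> FG; have [_ [x GBx]] := bF.1 _ (bF.2 _ _ FG FB).
  split; first by exists (a x), x.
  by exists M => _ [y [_ By] <-]; have /andP[] := aM _ By.
pose l := inf [set h G | G in F].
have linf : has_inf [set h G | G in F].
  split; first by exists (h B), B.
  exists 0 => _ [G FG <-]; have [_ [x GBx]] := bF.1 _ (bF.2 _ _ FG FB).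
  have /andP[ax _] := aM _ GBx.2; apply: (le_trans ax).
  by apply: sup_upper_bound; [exact: hsup|exists x].
have [_ [G FG <-] hG] := inf_adherent e0 linf.
pose S := B `&` [set x | l - e <= a x].
pose F' := F `|` [set G' `&` S | G' in F].
have SI : midconvex S.
  move=> x y [Bx ax] [By ay]; split; first exact: (bF.1 _ FB).1.
  by have := conc _ _ Bx By => /=; move: ax ay => /=; lra.
have bF' : convex_base F'.
  split=> [A [FA|[G' FG' <-]]|A A']; first exact: bF.1.
    split; first by move=> x y [Gx Sx] [Gy Sy]; split; [exact: (bF.1 _ FG').1|exact: SI].
    have [_ [x [Gx Bx] <-] hx] := sup_adherent e0 (hsup _ FG').
    exists x; split=> //; split=> //=; apply: ltW; apply: le_lt_trans hx.
    apply: lerB => //; apply: ge_inf; last by exists G'.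
    by have [] := linf.
  move=> [FA|[G1 FG1 <-]] [FA'|[G2 FG2 <-]].
  - by left; exact: bF.2.
  - by right; exists (A `&` G2); [exact: bF.2|rewrite setIA].
  - by right; exists (G1 `&` A'); [exact: bF.2|rewrite setIAC].
  - by right; exists (G1 `&` G2); [exact: bF.2|rewrite setIACA setIid].
exists (G `&` S), l; split.
- by apply: (maxF _ bF') => [A ?|]; [left|right; exists G].
- by move=> x [_ []].
- move=> x [Gx [Bx ax]]; rewrite ax /=; apply: le_trans (ltW hG).
  by apply: sup_upper_bound; [exact: hsup|exists x].
Qed.
End ConvexFamilies.

(** * Positive vectors almost below members of a convex family *)

Section Selection.
Context {R : realType} {X : banachLatticeType R} {Y : normedModType R}.
Context {iota : X -> Y -> R^o} (XY : dual_identification iota) (w0 : Y).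
Implicit Types (x y z t s : X) (S : set X).
Notation phi := (predual_pos (iota := iota) w0).

Let phiD := predual_posD XY w0.
Let phi_ge0 := predual_pos_ge0 XY w0.
Let phi_sup := predual_pos_sup XY (w := w0).

Let phi_mono x y : 0 <=: x -> x <=: y -> phi x <= phi y.
Proof.
move=> xge xy; have -> : y = x + (y - x) by lmod.
by rewrite phiD// -?ble_sub0// lerDl; apply: phi_ge0; rewrite -ble_sub0.
Qed.

Let phi0 : phi 0 = 0.
Proof. by have := phiD (ble_refl 0) (ble_refl 0); rewrite addr0; lra. Qed.

Let phiMn x n : 0 <=: x -> phi (x *+ n) = n%:R * phi x.
Proof.
move=> xge; have nge k : 0 <=: x *+ k by rewrite -[0](mul0rn _ k); exact: bleMn.
elim: n => [|n IH]; first by rewrite mulr0n mul0r phi0.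
by rewrite mulrS phiD// IH -addn1 natrD; ring.
Qed.

Let sum_ge0 n (g : nat -> X) : (forall i, 0 <=: g i) -> 0 <=: \sum_(i < n) g i.
Proof. by move=> h; elim/big_ind: _ => // *; exact: bleD_ge0. Qed.

Let phi_sum n (g : nat -> X) : (forall i, 0 <=: g i) ->
  phi (\sum_(i < n) g i) = \sum_(i < n) phi (g i).
Proof.
move=> h; elim: n => [|n IH]; first by rewrite !big_ord0.
by rewrite !big_ord_recr /= phiD ?IH//; exact: sum_ge0.
Qed.

(** With [u = x0 / m], the function [a x], the sum of the [phi (x \m j *: u)], is
concave. If it almost takes the same value at [x], at [y] and at their midpoint,
then the gaps in the concavity of all the [x |-> x \m (j *: u)] have a small
sum [s] for [phi]. By [modulus_dist_meet], half of [modulus (x - y)] minus [s]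
is a common lower bound of the distances from the midpoint to the grid, hence at
most [u] by [grid_ble]. *)
Lemma small_diameter F B x0 e : convex_base F ->
  (forall F', convex_base F' -> F `<=` F' -> F' `<=` F) ->
  F B -> (forall x, B x -> 0 <=: x /\ x <=: x0) -> 0 < e ->
  exists G, F G /\ forall x y, G x -> G y -> phi (modulus (x - y)) <= e.
Proof.
move=> bF maxF FB Bx0 e0.
have [_ [xB BxB]] := bF.1 _ FB.
have x0ge : 0 <=: x0 by have [h1 h2] := Bx0 _ BxB; exact: ble_trans h2.
have [n hn] : exists n : nat, 4 * phi x0 / e < n.+1%:R.
  have /archi_boundP : 0 <= 4 * phi x0 / e.
    by rewrite divr_ge0 ?mulr_ge0 ?phi_ge0// ltW.
  set n := (X in _ < X%:R) => h; exists n; apply: (lt_trans h).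
  by rewrite ltr_nat; exact: ltnSn.
pose m := n.+1.
have m0 : 0 < m%:R :> R by rewrite ltr0n.
pose u := m%:R^-1 *: x0.
have uge : 0 <=: u by apply: bl_scale_ge0 => //; rewrite invr_ge0 ltW.
have muE : m%:R *: u = x0 by rewrite scalerA mulfV ?scale1r// gt_eqF.
have phiu : phi u <= e / 4.
  have : m%:R * phi u = phi x0 by rewrite -phiMn// -scaler_nat muE.
  have : 4 * phi x0 / e < m%:R by [].
  rewrite ltr_pdivrMr// => h1 h2; rewrite ler_pdivlMr//; nra.
pose a x := \sum_(j < m.+1) phi (x \m (j%:R *: u)).
have juge j : 0 <=: (j%:R : R) *: u by exact: bl_scale_ge0.
have aM x : B x -> 0 <= a x <= m.+1%:R * phi x0.
  move=> /Bx0[xge xx0]; apply/andP; split.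
    by apply: sumr_ge0 => j _; apply: phi_ge0; apply: meet_ge0.
  have -> : m.+1%:R * phi x0 = \sum_(j < m.+1) phi x0.
    by rewrite sumr_const card_ord mulr_natl.
  apply: ler_sum => j _; apply: phi_mono; first by apply: meet_ge0.
  exact: (ble_trans (ble_meetl _ _) xx0).
pose g x y j := ((2^-1 *: (x + y)) \m (j%:R *: u)) *+ 2
  - x \m (j%:R *: u) - y \m (j%:R *: u).
have gge x y j : 0 <=: g x y j by exact: meet_midpoint.
have ag x y : B x -> B y ->
    \sum_(j < m.+1) phi (g x y j) + a x + a y = 2 * a (2^-1 *: (x + y)).
  move=> Bx By; have [xge _] := Bx0 _ Bx; have [yge _] := Bx0 _ By.
  have [mge _] := Bx0 _ ((bF.1 _ FB).1 _ _ Bx By).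
  rewrite /a -!big_split mulr_sumr /=; apply: eq_bigr => j _.
  have -> : 2 * phi ((2^-1 *: (x + y)) \m (j%:R *: u)) =
      phi (((2^-1 *: (x + y)) \m (j%:R *: u)) *+ 2).
    by rewrite phiMn//; apply: meet_ge0.
  have -> : ((2^-1 *: (x + y)) \m (j%:R *: u)) *+ 2 =
     g x y j + x \m (j%:R *: u) + y \m (j%:R *: u) by rewrite /g; lmod.
  have ux := meet_ge0 xge (juge j); have uy := meet_ge0 yge (juge j).
  by rewrite (phiD (bleD_ge0 (gge x y j) ux) uy) (phiD (gge x y j) ux).
have conc x y : B x -> B y -> a x + a y <= 2 * a (2^-1 *: (x + y)).
  move=> Bx By; rewrite -ag// -addrA lerDr; apply: sumr_ge0 => j _; exact: phi_ge0.
(* On [G] the values of [a] differ from [l] by at most [e / 16], and the gaps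
   add up to [2 a (2^-1 *: (x + y)) - a x - a y <= 4 * (e / 16)]. *)
have e16 : 0 < e / 16 by rewrite divr_gt0.
have [G [l [FG GB Gl]]] := slice_oscillation bF maxF FB aM conc e16.
exists G; split=> // x y Gx Gy.
have Bx := GB _ Gx; have By := GB _ Gy.
have Gm : G (2^-1 *: (x + y)) by exact: (bF.1 _ FG).1.
pose s := \sum_(j < m.+1) g x y j.
have sge : 0 <=: s by exact: sum_ge0.
have phis : phi s <= e / 4.
  rewrite /s phi_sum//.
  have := ag _ _ Bx By; move: (Gl _ Gx) (Gl _ Gy) (Gl _ Gm) => /andP[? ?] /andP[? ?] /andP[? ?].
  lra.
have gs j : (j < m.+1)%N -> g x y j <=: s.
  move=> jm; rewrite /s (bigD1 (Ordinal jm))//= -[X in X <=: _]addr0.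
  by apply: bleD => //; elim/big_ind: _ => // *; exact: bleD_ge0.
have hs : 2^-1 *: modulus (x - y) - s <=: u.
  apply: (@grid_ble _ _ (2^-1 *: (x + y)) _ _ m) => //.
  - by have [] := Bx0 _ (GB _ Gm).
  - by rewrite muE; have [] := Bx0 _ (GB _ Gm).
  move=> j jm; have h1 := modulus_dist_meet x y (j%:R *: u).
  have h2 := gs j jm.
  apply: (@bleZI _ _ 2) => //.
  have hM := double_half (modulus (x - y)); move: hM h1.
  set v := 2^-1 *: modulus (x - y) => <- h1.
  by apply: (ble_lin3 h1 h2 h2 _); rewrite /g; lmod.
have : modulus (x - y) <=: u *+ 2 + s *+ 2.
  have := bleMn 2 hs; rewrite mulrnBl double_half => h; apply: (ble_lin h _); lmod.
have uge2 : 0 <=: u *+ 2 by rewrite -[0](mul0rn _ 2); exact: bleMn.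
have sge2 : 0 <=: s *+ 2 by rewrite -[0](mul0rn _ 2); exact: bleMn.
move=> /(phi_mono (modulus_ge0 _))/le_trans; apply.
by rewrite phiD// !phiMn//; lra.
Qed.

Let geo_bound n0 k : \sum_(i < k) 2^-1 ^+ (n0 + i) <= 2 * 2^-1 ^+ n0 :> R.
Proof.
have -> : \sum_(i < k) 2^-1 ^+ (n0 + i) = 2 * 2^-1 ^+ n0 - 2 * 2^-1 ^+ (n0 + k) :> R.
  elim: k => [|k IH]; first by rewrite big_ord0 addn0 subrr.
  by rewrite big_ord_recr /= IH addnS exprS; field.
by rewrite gerBl mulr_ge0// exprn_ge0// invr_ge0.
Qed.

Let geo_small (c : R) : 0 < c -> exists n : nat, 2 * 2^-1 ^+ n <= c.
Proof.
move=> c0; have /archi_boundP : 0 <= 2 / c by rewrite divr_ge0// ltW.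
set k := (X in _ < X%:R) => h; exists k.
have kk : k%:R <= 2 ^+ k :> R by rewrite -natrX ler_nat ltnW// ltn_expl.
rewrite exprVn -/(2 / _) ler_pdivrMr ?exprn_gt0//.
move: h; rewrite ltr_pdivrMr// => h; apply: (le_trans (ltW h)); rewrite mulrC.
by apply: ler_wpM2l => //; exact: ltW.
Qed.

(** In a maximal family containing [F0], choose members [H n] decreasing with
[n], of diameter at most [2^-1 ^+ n] for [phi], and [z n] in [H n]. The infimum
of the [z n] from a suitable index [n0] on is nonzero, because [phi] loses
little. If [A] belongs to the family then it meets each [H (n0 + n)] in a vector
[z' n] close to [z (n0 + n)], and the supremum [W m] of the positive parts of
the [x - z' n], [n >= m], satisfies [phi (W m) <= 2 * 2^-1 ^+ m]. *)
Lemma order_selection F0 B x0 (c : R) : convex_base F0 ->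
  F0 B -> (forall x, B x -> 0 <=: x /\ x <=: x0) ->
  0 < c -> (forall x, B x -> c <= phi x) ->
  exists x, [/\ 0 <=: x, x <=: x0, x <> 0 &
    forall G, F0 G -> exists W : nat -> X,
    [/\ forall m, 0 <=: W m, forall m, W m <=: x, forall m, W m.+1 <=: W m,
      forall e, 0 <=: e -> (forall m, e <=: W m) -> e = 0 &
      forall m, exists2 z, G z & x - W m <=: z]].
Proof.
move=> bF0 F0B Bx0 c0 Bc.
have [F [F0F bF maxF]] := maximal_convex_base bF0.
have FB := F0F _ F0B.
have half0 n : 0 < 2^-1 ^+ n :> R by rewrite exprn_gt0// invr_gt0.
have /choice[G hG] : forall n, exists G, F G /\ forall x y, G x -> G y ->
    phi (modulus (x - y)) <= 2^-1 ^+ n.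
  by move=> n; exact: (small_diameter bF maxF FB Bx0 (half0 n)).
pose fix H n := if n is m.+1 then H m `&` G n else B `&` G 0%N.
have FH n : F (H n) by elim: n => [|n IH] /=; apply: bF.2 => //; exact: (hG _).1.
have HG n : H n `<=` G n by case: n => [|n] x [].
have HB n : H n `<=` B by elim: n => [|n IH] x [] // /IH.
have Hle n k : H (n + k)%N `<=` H n.
  by elim: k => [|k IH]; rewrite ?addn0// addnS => x [/IH].
have /choice[z hz] : forall n, exists z, H n z by move=> n; have [_] := bF.1 _ (FH n).
have zge n : 0 <=: z n by have [] := Bx0 _ (HB _ _ (hz n)).
have zx0 n : z n <=: x0 by have [] := Bx0 _ (HB _ _ (hz n)).
have zB n : B (z n) by exact: (HB _ _ (hz n)).
have Hphi n x y : H n x -> H n y -> phi (modulus (x - y)) <= 2^-1 ^+ n.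
  by move=> /HG Gx /HG Gy; exact: (hG n).2.
have [n0 hn0] : exists n, 2 * 2^-1 ^+ n <= c / 2 by apply: geo_small; rewrite divr_gt0.
(* The index [n0] leaves a total decrease of at most [c / 2]. *)
pose fix d k := if k is j.+1 then d j \m z (n0 + k)%N else z n0.
have dge k : 0 <=: d k by elim: k => //= k IH; exact: meet_ge0.
have dz k : d k <=: z (n0 + k)%N by case: k => [|k]; rewrite ?addn0//=; exact: ble_meetr.
have dS k : d k.+1 <=: d k by exact: ble_meetl.
have ddec k j : d (k + j)%N <=: d k.
  by elim: j => [|j IH]; rewrite ?addn0// addnS; exact: (ble_trans (dS _)).
have dphi k : phi (z n0 - d k) <= \sum_(i < k) 2^-1 ^+ (n0 + i).
  elim: k => [|k IH]; first by rewrite /= subrr phi0 big_ord0.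
  rewrite big_ord_recr /=.
  have -> : z n0 - d k \m z (n0 + k.+1)%N = (z n0 - d k) + pospart (d k - z (n0 + k.+1)%N).
    by rewrite meetE; lmod.
  have d0 : 0 <=: z n0 - d k by rewrite -ble_sub0; exact: (ddec 0%N k).
  rewrite phiD//; apply: lerD => //.
  apply: le_trans (Hphi (n0 + k)%N _ _ (hz _) (Hle _ 1%N _ _)); last first.
    by rewrite addn1 -addnS; exact: hz.
  apply: phi_mono => //; apply: ble_trans (pospart_ble_modulus _).
  by apply: pospart_mono; apply: (ble_lin (dz k) _); lmod.
pose S := [set z n0 - d k | k in [set: nat]].
have S0 : exists x, S x by exists (z n0 - d 0%N), 0%N.
have dirS : directed S.
  move=> _ _ [i _ <-] [j _ <-]; exists (z n0 - d (i + j)%N); split; first by exists (i + j)%N.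
    by apply: (ble_lin (ddec i j) _); lmod.
  by rewrite addnC; apply: (ble_lin (ddec j i) _); lmod.
have Sz : upper_bound S (z n0).
  by move=> _ [k _ <-]; apply: (ble_lin (dge k) _); lmod.
have [s [[Ss sS] _]] := directed_supremum XY S0 dirS Sz.
pose x1 := z n0 - s.
have x1ge : 0 <=: x1 by rewrite -ble_sub0; exact: sS.
have x1d k : x1 <=: d k.
  have h := Ss _ (ex_intro2 _ _ k I erefl).
  by apply: (ble_lin h _); rewrite /x1; lmod.
have x1z n : x1 <=: z (n0 + n)%N by exact: (ble_trans (x1d n)).
have sge : 0 <=: s.
  by have := Ss _ (ex_intro2 _ _ 0%N I erefl); rewrite subrr.
have phis : phi s <= c / 2.
  apply: (phi_sup S0 dirS (conj Ss sS)).
    by move=> _ [k _ <-]; rewrite -ble_sub0; exact: (ddec 0%N k).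
  by move=> _ [k _ <-]; apply: (le_trans (dphi k)); exact: le_trans (geo_bound _ _) hn0.
have phix1 : 0 < phi x1.
  have : phi (z n0) = phi x1 + phi s by rewrite -phiD//; congr predual_pos; rewrite /x1; lmod.
  by have := Bc _ (zB n0); lra.
(* [phi (W m)] tending to 0 makes [W m] decrease to 0 only where [phi] is
   strictly positive: the largest null part [h] of [x1] has to be removed. *)
pose N := [set h | [/\ 0 <=: h, h <=: x1 & phi h = 0]].
have N0 : exists x, N x by exists 0; split.
have dirN : directed N.
  move=> h k [hge hx1 ph] [kge kx1 pk]; exists (h \j k).
  have hk : 0 <=: h \j k by exact: ble_trans (ble_joinl _ _).
  split; [|exact: ble_joinl|exact: ble_joinr].
  split=> //; first exact: join_ble.
  apply/eqP; rewrite eq_le phi_ge0// andbT.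
  have : h \j k <=: h + k.
    by apply: join_ble; [apply: (ble_lin kge _)|apply: (ble_lin hge _)]; lmod.
  by move=> /(phi_mono hk); rewrite phiD// ph pk addr0.
have Nx1 : upper_bound N x1 by move=> h [].
have [h [[Nh hN] _]] := directed_supremum XY N0 dirN Nx1.
have hge : 0 <=: h by apply: Nh; split.
have phih : phi h = 0.
  apply/eqP; rewrite eq_le phi_ge0// andbT.
  by apply: (phi_sup N0 dirN (conj Nh hN)); [move=> ? []|move=> ? [_ _ ->]].
pose x := x1 - h.
have xge : 0 <=: x by rewrite -ble_sub0; exact: hN.
have xx1 : x <=: x1 by apply: (ble_lin hge _); rewrite /x; lmod.
have xx0 : x <=: x0 by have := x1d 0%N => /(ble_trans xx1)/ble_trans; apply; exact: zx0.
have xstrict e : 0 <=: e -> e <=: x -> phi e = 0 -> e = 0.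
  move=> ege ex pe; have : e + h <=: h.
    apply: Nh; split; [exact: bleD_ge0| |by rewrite phiD// pe phih addr0].
    by apply: (ble_lin ex _); rewrite /x; lmod.
  by move=> eh; apply: ble_anti => //; apply: (ble_lin eh _); lmod.
exists x; split=> //.
  move=> x_0; have x1h : x1 = h by rewrite -[x1](subrK h) -/x x_0 add0r.
  by move: phix1; rewrite x1h phih ltxx.
move=> A /F0F FA.
have /choice[z' hz'] : forall n, exists z', (A `&` H (n0 + n)%N) z'.
  by move=> n; have [_] := bF.1 _ (bF.2 _ _ FA (FH (n0 + n)%N)).
pose w n := pospart (x - z' n).
have wge n : 0 <=: w n by exact: pospart_ge0.
have z'ge n : 0 <=: z' n by have [] := Bx0 _ (HB _ _ (hz' n).2).
have wx n : w n <=: x by apply: join_ble => //; apply: (ble_lin (z'ge n) _); lmod.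
have phiw n : phi (w n) <= 2^-1 ^+ n.
  have := Hphi _ _ _ (hz (n0 + n)%N) (hz' n).2 => h1.
  have h2 : (2^-1 : R) ^+ (n0 + n) <= 2^-1 ^+ n.
    rewrite exprD ler_piMl// ?exprn_ge0 ?invr_ge0//.
    by apply: exprn_ile1; rewrite ?invr_ge0// invf_le1// ler1n.
  apply: le_trans h2; apply: le_trans h1; apply: phi_mono => //.
  apply: ble_trans (pospart_ble_modulus _); apply: pospart_mono.
  by apply: (ble_lin2 (x1z n) xx1 _); lmod.
pose fix t m j := if j is i.+1 then t m i \j w (m + j)%N else w m.
have tge m j : 0 <=: t m j by elim: j => //= j IH; exact: ble_trans (ble_joinl _ _).
have tx m j : t m j <=: x by elim: j => //= j IH; exact: join_ble.
have tinc m i j : t m i <=: t m (i + j)%N.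
  elim: j => [|j IH]; rewrite ?addn0// addnS.
  exact: ble_trans IH (ble_joinl _ _).
have tphi m j : phi (t m j) <= \sum_(i < j.+1) 2^-1 ^+ (m + i).
  elim: j => [|j IH]; first by rewrite big_ord1 /= addn0; exact: phiw.
  rewrite big_ord_recr /=.
  have : t m j \j w (m + j.+1)%N <=: t m j + w (m + j.+1)%N.
    by apply: join_ble; [apply: (ble_lin (wge (m + j.+1)%N) _)|apply: (ble_lin (tge m j) _)]; lmod.
  move=> /(phi_mono (tge m j.+1))/le_trans; apply; rewrite phiD//.
  exact: lerD.
have tS m j : t m.+1 j <=: t m j.+1.
  elim: j => [|j IH]; first by rewrite /= addn1; exact: ble_joinr.
  by rewrite /= addSnnS; apply: ble_join2.
have /choice[W hW] : forall m, exists W, is_supremum [set t m j | j in [set: nat]] W /\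
    phi W <= 2 * 2^-1 ^+ m.
  move=> m; have T0 : exists x, [set t m j | j in [set: nat]] x by exists (t m 0%N), 0%N.
  have dirT : directed [set t m j | j in [set: nat]].
    move=> _ _ [i _ <-] [j _ <-]; exists (t m (i + j)%N); split; first by exists (i + j)%N.
      exact: tinc.
    by rewrite addnC; exact: tinc.
  have Tx : upper_bound [set t m j | j in [set: nat]] x by move=> _ [j _ <-]; exact: tx.
  have [W [sW _]] := directed_supremum XY T0 dirT Tx.
  exists W; split=> //; apply: (phi_sup T0 dirT sW).
    by move=> _ [j _ <-]; exact: tge.
  by move=> _ [j _ <-]; apply: (le_trans (tphi m j)); exact: geo_bound.
have tW m j : t m j <=: W m by apply: (hW m).1.1; exists j.
have Wge m : 0 <=: W m by exact: ble_trans (tge m 0%N) (tW m 0%N).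
have Wx m : W m <=: x by apply: (hW m).1.2 => _ [j _ <-]; exact: tx.
exists W; split=> //.
- move=> m; apply: (hW m.+1).1.2 => _ [j _ <-].
  exact: ble_trans (tS m j) (tW m j.+1).
- move=> e ege eW; apply: xstrict => //; first exact: ble_trans (eW 0%N) (Wx 0%N).
  apply/eqP; rewrite eq_le phi_ge0// andbT leNgt; apply/negP => pe.
  have [k hk] : exists n, 2 * 2^-1 ^+ n <= phi e / 2 by apply: geo_small; rewrite divr_gt0.
  by have := phi_mono ege (eW k); have := (hW k).2; lra.
- move=> m; exists (z' m); first exact: (hz' m).1.
  have h1 : w m <=: W m by exact: (tW m 0%N).
  have h2 := ble_pospart (x - z' m).
  by apply: (ble_lin2 h1 h2 _); rewrite /w; lmod.
Qed.
End Selection.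

(** * The Hahn-Banach theorem *)

Section HahnBanach.
Context {R : realType} {V : lmodType R}.
Implicit Types (p q : V -> R) (u v x : V).

Definition sublinear p := (forall u v, p (u + v) <= p u + p v) /\
  (forall a v, 0 < a -> p (a *: v) <= a * p v).

Lemma sublinear0 p : sublinear p -> p 0 = 0.
Proof.
move=> [_ ph]; have h1 := ph 2 0 (ltr0Sn _ 1).
have h2 : p (2^-1 *: 0) <= 2^-1 * p 0 by apply: ph; rewrite invr_gt0.
by move: h1 h2; rewrite !scaler0; lra.
Qed.

Lemma sublinearN p v : sublinear p -> - p (- v) <= p v.
Proof.
by move=> sp; have := sp.1 v (- v); rewrite subrr sublinear0//; lra.
Qed.

(** The infimum over [t >= 0] of [p (v + t *: x) - t * p x] defines such a [p'].
Consequently a minimal sublinear function is odd. *)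
Lemma sublinear_reduce p x : sublinear p ->
  exists p', [/\ sublinear p', forall v, p' v <= p v & p' (- x) <= - p x].
Proof.
move=> sp; have [padd ph] := sp.
pose A v := [set p (v + t *: x) - t * p x | t in [set t : R | 0 <= t]].
have phe t v : 0 < t -> p (t *: v) = t * p v.
  move=> t0; apply/eqP; rewrite eq_le ph//=.
  have := ph t^-1 (t *: v); rewrite invr_gt0 scalerA mulVf ?gt_eqF// scale1r.
  by move=> /(_ t0); rewrite ler_pdivlMl.
have lbA v : lbound (A v) (- p (- v)).
  move=> _ [t /= t0 <-].
  have : t * p x <= p (v + t *: x) + p (- v).
    have [->|tn0] := eqVneq t 0.
      by rewrite mul0r scale0r addr0; have := sublinearN v sp; lra.
    rewrite -phe ?lt0r ?tn0//; have := padd (v + t *: x) (- v).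
    by rewrite (_ : v + t *: x - v = t *: x) //; lmod.
  lra.
have A0 v : A v !=set0 by exists (p (v + 0 *: x) - 0 * p x), 0 => /=.
have hasA v : has_inf (A v) by split=> //; exists (- p (- v)).
pose p' v := inf (A v).
have p'le v t : 0 <= t -> p' v <= p (v + t *: x) - t * p x.
  by move=> t0; apply: ge_inf; [case: (hasA v)|exists t].
exists p'; split; first split.
- move=> u v; rewrite -lerBlDr; apply: lb_le_inf => // _ [t /= t0 <-].
  rewrite lerBlDl -lerBlDr; apply: lb_le_inf => // _ [s /= s0 <-].
  rewrite lerBlDr; apply: (le_trans (p'le (u + v) (t + s) (addr_ge0 t0 s0))).
  have := padd (u + t *: x) (v + s *: x).
  rewrite (_ : u + t *: x + (v + s *: x) = u + v + (t + s) *: x); last by lmod.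
  lra.
- move=> a v a0; rewrite -ler_pdivrMl//; apply: lb_le_inf => // _ [t /= t0 <-].
  rewrite ler_pdivrMl//; apply: (le_trans (p'le (a *: v) (a * t) (mulr_ge0 (ltW a0) t0))).
  have -> : a *: v + (a * t) *: x = a *: (v + t *: x) by lmod.
  by rewrite phe//; lra.
- by move=> v; have := p'le v 0 (lexx 0); rewrite scale0r mul0r addr0 subr0.
- have := p'le (- x) 1 ler01; rewrite scale1r mul1r addNr sublinear0//; lra.
Qed.

(** A minimal sublinear function below [q] is odd by [sublinear_reduce], hence
linear. Starting the descent from the reduction of [q] at [x] fixes the value
at [x]. *)
Theorem hahn_banach_at q x : sublinear q ->
  exists f : V -> R, [/\ forall a u v, f (a *: u + v) = a * f u + f v,
    forall v, f v <= q v & q x <= f x].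
Proof.
move=> /(sublinear_reduce x)[q' [sq' q'q q'x]].
pose T := {p : V -> R | sublinear p /\ forall v, p v <= q' v}.
pose r (s t : T) := `[< forall v, sval t v <= sval s v >].
have t0 : T by exists q'; split.
have [] := @ZL_preorder T t0 r.
- by move=> t; apply/asboolP => v.
- by move=> s t u /asboolP st /asboolP tu; apply/asboolP => v; exact: le_trans (st v).
- move=> A totA; have [[s0 As0]|A0] := pselect (exists s, A s); last first.
    by exists t0 => s As; case: A0; exists s.
  pose B v := [set sval s v | s in A].
  have lbB v : lbound (B v) (- q' (- v)).
    move=> _ [s As <-]; apply: le_trans (sublinearN v (svalP s).1).
    by rewrite lerN2; exact: (svalP s).2.
  have B0 v : B v !=set0 by exists (sval s0 v), s0.
  have Ble v s : A s -> inf (B v) <= sval s v.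
    by move=> As; apply: ge_inf; [exists (- q' (- v))|exists s].
  have sinf : sublinear (fun v => inf (B v)) /\ forall v, inf (B v) <= q' v.
    split; last by move=> v; apply: (le_trans (Ble v _ As0)); exact: (svalP s0).2.
    split.
      move=> u v; rewrite -lerBlDr; apply: lb_le_inf => // _ [s1 As1 <-].
      rewrite lerBlDl -lerBlDr; apply: lb_le_inf => // _ [s2 As2 <-].
      rewrite lerBlDr; have [/asboolP h|/asboolP h] := totA _ _ As1 As2.
        apply: (le_trans (Ble (u + v) _ As2)); apply: (le_trans ((svalP s2).1.1 u v)).
        by have := h u; have := h v; lra.
      apply: (le_trans (Ble (u + v) _ As1)); apply: (le_trans ((svalP s1).1.1 u v)).
      by have := h u; have := h v; lra.
    move=> a v a0; rewrite -ler_pdivrMl//; apply: lb_le_inf => // _ [s As <-].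
    rewrite ler_pdivrMl//; apply: (le_trans (Ble (a *: v) _ As)).
    exact: (svalP s).1.2.
  exists (exist (fun p : V -> R => sublinear p /\ forall v, p v <= q' v)
    (fun v => inf (B v)) sinf) => s As; apply/asboolP => v /=; exact: Ble.
move=> [p [sp pq']] pmin; have [padd ph] := sp.
have pN v : p (- v) = - p v.
  apply/eqP; rewrite eq_le; apply/andP; split; last first.
    by have := sublinearN v sp; lra.
  have [p' [sp' p'p p'v]] := sublinear_reduce v sp.
  have p'q w : p' w <= q' w by exact: le_trans (pq' w).
  have /asboolP h := pmin (exist (fun p : V -> R => sublinear p /\ forall v, p v <= q' v)
    p' (conj sp' p'q)) (introT (asboolP _) p'p).
  exact: le_trans (h (- v)) p'v.
have pD u v : p (u + v) = p u + p v.
  apply/eqP; rewrite eq_le padd/=; have := padd (u + v) (- v).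
  by rewrite addrK pN; lra.
have pZ a v : 0 < a -> p (a *: v) = a * p v.
  move=> a0; apply/eqP; rewrite eq_le ph//=; have := ph a (- v) a0.
  by rewrite scalerN !pN; lra.
exists p; split.
- move=> a u v; rewrite pD; congr (_ + _); have [a0|a0|->] := ltgtP a 0.
  + have := pZ (- a) u; rewrite oppr_gt0 scaleNr pN => /(_ a0); lra.
  + exact: pZ.
  + by rewrite scale0r mul0r sublinear0.
- by move=> v; exact: le_trans (q'q v).
- have := pq' (- x); rewrite pN; lra.
Qed.
End HahnBanach.

(** * Essential norms and weak-star limits *)

Section EssentialBound.
Context {R : realType} {X : banachLatticeType R} {Y : completeNormedModType R}.
Context {iota : X -> Y -> R^o} (XY : dual_identification iota).
Implicit Types (T : X -> X) (mu e : R).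

(** Finitely many balls of radius arbitrarily close to [mu] cover the image of
the unit ball under a preadjoint. Every bound on the essential norm implies such
coverings, which add up and pass to weak-star limits more readily. *)
Definition ess_bounded T mu := exists S : Y -> Y, is_adjoint iota T S /\
  forall e, 0 < e -> exists L : seq Y,
    forall y, `|y| <= 1 -> exists2 l, l \in L & `|S y - l| <= mu + e.

Lemma compact_finite_net (A : set Y) e : compact (closure A) -> 0 < e ->
  exists L : seq Y, forall a, A a -> exists2 l, l \in L & `|a - l| < e.
Proof.
rewrite compact_cover => cA e0.
have [] := cA Y (closure A) (fun y => ball y e).
- by move=> y _; exact: ball_open.
- by move=> y Ay; exists y => //; exact: ballxx.
move=> D DA cD; exists (finmap.enum_fset D) => a Aa; have [l /= lD] := cD _ (subset_closure Aa).
by rewrite -ball_normE /= distrC => al; exists l.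
Qed.

Lemma ess_bounded_ge0 T mu : ess_bounded T mu -> 0 <= mu.
Proof.
move=> [S [_ h]]; apply/ler_addgt0Pr => e e0; have [L hL] := h e e0.
have [|l _ hl] := hL 0; first by rewrite normr0.
exact: le_trans hl.
Qed.

Lemma ess_boundedD T T' mu mu' : ess_bounded T mu -> ess_bounded T' mu' ->
  ess_bounded (fun x => T x + T' x) (mu + mu').
Proof.
move=> [S [aS hS]] [S' [aS' hS']]; exists (fun y => S y + S' y); split.
  move=> x y; have [lin _] := iota_dual XY x.
  rewrite (iota_add XY) aS aS'; have := lin 1 (S y) (S' y).
  by rewrite !scale1r => ->.
move=> e e0; have e2 : 0 < e / 2 by rewrite divr_gt0.
have [L hL] := hS _ e2; have [L' hL'] := hS' _ e2.
exists [seq l + l' | l <- L, l' <- L'] => y y1.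
have [l lL h] := hL y y1; have [l' lL' h'] := hL' y y1.
exists (l + l'); first exact: allpairs_f.
have -> : S y + S' y - (l + l') = (S y - l) + (S' y - l') by rewrite opprD addrACA.
by apply: (le_trans (ler_normD _ _)); lra.
Qed.

Lemma ess_boundedZ T mu (a : R) : 0 < a -> ess_bounded T mu ->
  ess_bounded (fun x => a *: T x) (a * mu).
Proof.
move=> a0 [S [aS hS]]; exists (fun y => a *: S y); split.
  move=> x y; have [lin _] := iota_dual XY x.
  have := lin a (S y) 0; rewrite addr0 => ->.
  have := iota_lin XY a (T x) 0 y; rewrite addr0 (iota_zero XY) addr0 => ->.
  have -> : iota x 0 = 0 by have := lin (-1) 0 0; rewrite scaler0 addr0 scaleN1r addNr.
  by rewrite addr0 aS.
move=> e e0; have ea : 0 < e / a by rewrite divr_gt0.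
have [L hL] := hS _ ea; exists [seq a *: l | l <- L] => y y1.
have [l lL h] := hL y y1; exists (a *: l); first exact: map_f.
rewrite -scalerBr normrZ gtr0_norm//; apply: (le_trans (ler_wpM2l (ltW a0) h)).
by rewrite mulrDr (mulrC a (e / a)) divfK// gt_eqF.
Qed.

(** On a finite net of the image of the unit ball the weak-star convergence is
uniform; replacing [S y] by a point of the net costs [D * mu] and a little
more. *)
Lemma ess_bounded_wlim T mu (G : set_system X) {FG : ProperFilter G} z D e :
  ess_bounded T mu -> wlim iota G z -> G [set x | `|x - z| <= D] -> 0 < e ->
  G [set x | `|T x - T z| <= D * mu + e].
Proof.
move=> [S [aS hS]] Gz GD e0.
have D0 : 0 <= D by have [x /= h] := filter_ex GD; exact: le_trans h.
pose e' := e / (D + 1).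
have D1 : 0 < D + 1 by rewrite ltr_wpDl.
have e'0 : 0 < e' by rewrite divr_gt0.
have [L hL] := hS e' e'0.
have GL : G [set x | forall l, l \in L -> `|iota (x - z) l : R| < e'].
  elim: L {hL} => [|l L IH]; first by apply: filterS filterT.
  apply: filterS (filterI (Gz l e' e'0) IH) => x [/= h1 h2] k.
  by rewrite inE => /orP[/eqP->|/h2].
apply: filterS (filterI GD GL) => x [/= xD xL].
apply: (iota_norm_le XY) => y y1; have [l lL hl] := hL y y1.
have -> : iota (T x - T z) y = iota (x - z) (S y - l) + iota (x - z) l :> R.
  rewrite (iota_sub XY) aS aS -(iota_sub XY).
  have [lin _] := iota_dual XY (x - z).
  by have := lin 1 (S y - l) l; rewrite !scale1r subrK => ->.
apply: (le_trans (ler_normD _ _)).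
have h1 : `|iota (x - z) (S y - l) : R| <= D * (mu + e').
  apply: (le_trans (iota_le XY _ _)).
  by apply: ler_pM.
apply: (le_trans (lerD h1 (ltW (xL _ lL)))).
by rewrite mulrDr -addrA lerD2l -[X in _ + X]mul1r -mulrDl /e' mulrC divfK// gt_eqF.
Qed.

(** A compact operator at almost minimal distance provides the nets. *)
Lemma ess_bounded_essnorm T : adjoint_op iota T ->
  ess_bounded T (essnorm (preadjoint iota T)).
Proof.
move=> [_ [S' pS']].
have [[linS [M hM]] aS] : preadjoints iota T (preadjoint iota T).
  by apply: xgetPex; exists S'.
set S := preadjoint iota T in linS hM aS *.
have bSK K : bounded_op K -> bounded_op (S \- K).
  move=> [linK [N hN]]; split.
    by move=> a u v; rewrite /= linS linK scalerBr opprD addrACA.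
  exists (M + N) => v; apply: (le_trans (ler_normB _ _)); rewrite mulrDl.
  exact: lerD.
have hinf : has_inf [set opnorm (S \- K) | K in @compact_op R Y Y].
  split.
    exists (opnorm (S \- (fun=> 0))), (fun=> 0) => //; split.
      split; first by move=> a u v; rewrite scaler0 addr0.
      by exists 0 => v; rewrite normr0 mul0r.
    have -> : (fun=> 0) @` [set v : Y | `|v| <= 1] = [set (0 : Y)].
      apply/seteqP; split=> [_ [? _ <-//]|_ ->]; exists 0 => //=.
      by rewrite normr0.
    rewrite -(closure_id _).1; first exact: compact_set1.
    exact: (compact_closed (@norm_hausdorff _ _) (@compact_set1 _ _)).
  by exists 0 => _ [K cK <-]; exact: (opnorm_ge0 (bSK _ cK.1)).
exists S; split=> // e e0.
have e2 : 0 < e / 2 by rewrite divr_gt0.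
have [_ [K cK <-] hK] := inf_adherent e2 hinf.
have [L hL] := compact_finite_net cK.2 e2.
exists L => y y1; have [l lL hl] := hL (K y) (ex_intro2 _ _ y y1 erefl).
exists l => //; have -> : S y - l = (S \- K) y + (K y - l) by rewrite /= addrA subrK.
apply: (le_trans (ler_normD _ _)).
have := opnorm_ub (bSK K cK.1) y1.
by rewrite /essnorm in hK *; move: hl hK => /=; lra.
Qed.
End EssentialBound.

(** * Positive functionals dominated by a cone *)

Section Separation.
Context {R : realType} {X : banachLatticeType R}.
Implicit Types (x y z u v : X) (r mu d : R).

Lemma pospartD_le x y : pospart (x + y) <=: pospart x + pospart y.
Proof. by apply: join_ble; [exact: bleD (ble_pospart x) (ble_pospart y)|apply: bleD_ge0]. Qed.

Lemma pospartZ a x : 0 < a -> pospart (a *: x) = a *: pospart x.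
Proof.
move=> a0; have h b y : 0 < b -> pospart (b *: y) <=: b *: pospart y.
  move=> b0; apply: join_ble; last by apply: bl_scale_ge0 => //; exact: ltW.
  by apply: bleZ => //; exact: ltW.
apply: ble_anti; first exact: h.
apply: (@bleZI _ _ a^-1); first by rewrite invr_gt0.
have := h a^-1 (a *: x); rewrite invr_gt0 !scalerA mulVf ?gt_eqF// !scale1r.
exact.
Qed.

(** The function [q v = inf (`|pospart (v - u)| + mu)], over the pairs [(u, mu)]
of the cone [P], is sublinear; it is at most [`|pospart v|] at [v], at most [mu]
at [u], and at least [d] at [x0]. The positive part in its definition is what
makes the functional below it positive. *)
Lemma separating_functional (P : set (X * R)) x0 d :
  P (0, 0) ->
  (forall u mu u' mu', P (u, mu) -> P (u', mu') -> P (u + u', mu + mu')) ->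
  (forall a u mu, 0 < a -> P (u, mu) -> P (a *: u, a * mu)) ->
  (forall u mu, P (u, mu) -> 0 <= mu) ->
  (forall u mu, P (u, mu) -> d <= `|pospart (x0 - u)| + mu) ->
  exists f : X -> R, [/\ forall a u v, f (a *: u + v) = a * f u + f v,
    forall v, f v <= `|pospart v|, d <= f x0 &
    forall u mu, P (u, mu) -> f u <= mu].
Proof.
move=> P0 PD PZ Pge Pd.
pose A v := [set `|pospart (v - p.1)| + p.2 | p in P].
have A0 v : A v !=set0 by exists (`|pospart (v - 0)| + 0), (0, 0).
have lbA v : lbound (A v) 0.
  by move=> _ [[u mu] /Pge mu0 <-]; exact: addr_ge0.
pose q v := inf (A v).
have qle v u mu : P (u, mu) -> q v <= `|pospart (v - u)| + mu.
  by move=> Pu; apply: ge_inf; [exists 0|exists (u, mu)].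
have sq : sublinear q.
  split.
    move=> v v'; rewrite -lerBlDr; apply: lb_le_inf => // _ [[u mu] Pu <-] /=.
    rewrite lerBlDl -lerBlDr; apply: lb_le_inf => // _ [[u' mu'] Pu' <-] /=.
    rewrite lerBlDr; apply: (le_trans (qle (v + v') _ _ (PD _ _ _ _ Pu Pu'))).
    have : `|pospart (v + v' - (u + u'))| <= `|pospart (v - u)| + `|pospart (v' - u')|.
      have -> : v + v' - (u + u') = (v - u) + (v' - u') by lmod.
      apply: le_trans (ler_normD _ _); apply: norm_mono => //; exact: pospartD_le.
    lra.
  move=> a v a0; rewrite -ler_pdivrMl//; apply: lb_le_inf => // _ [[u mu] Pu <-] /=.
  rewrite ler_pdivrMl//; apply: (le_trans (qle (a *: v) _ _ (PZ _ _ _ a0 Pu))).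
  by rewrite -scalerBr pospartZ// normrZ gtr0_norm// mulrDr.
have [f [flin fq qf]] := hahn_banach_at x0 sq.
exists f; split=> //.
- by move=> v; apply: (le_trans (fq v)); have := qle v _ _ P0; rewrite subr0 addr0.
- by apply: le_trans qf; apply: lb_le_inf => // _ [[u mu] Pu <-]; exact: Pd.
- move=> u mu Pu; apply: (le_trans (fq u)); have := qle u _ _ Pu.
  by rewrite subrr (pospart_idl (ble_refl 0)) normr0 add0r.
Qed.

End Separation.

(** * Finite quasinilpotence *)

Section Quasinilpotence.
Context {R : realType} {X : banachLatticeType R}.
Implicit Types (x y z u v : X) (T S A : X -> X) (C F : set (X -> X)) (r e k : R).

Lemma positive_op_lin T a u v : positive_op T -> T (a *: u + v) = a *: T u + T v.
Proof. by move=> [[lin _] _]; exact: lin. Qed.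

Lemma positive_op0 T : positive_op T -> T 0 = 0.
Proof.
by move=> /(positive_op_lin (-1) 0 0); rewrite scaler0 addr0 scaleN1r addNr.
Qed.

Lemma positive_opB T u v : positive_op T -> T (u - v) = T u - T v.
Proof.
by move=> /(positive_op_lin (-1) v u); rewrite !scaleN1r addrC => ->; rewrite addrC.
Qed.

Lemma positive_op_ge0 T v : positive_op T -> 0 <=: v -> 0 <=: T v.
Proof. by move=> [_ Tpos] v0; apply: Tpos; exists v. Qed.

Lemma positive_op_mono T u v : positive_op T -> u <=: v -> T u <=: T v.
Proof.
by move=> pT; rewrite ble_sub0 [T u <=: _]ble_sub0 -positive_opB//; exact: positive_op_ge0.
Qed.

Lemma positive_op_norm T v : positive_op T -> `|T v| <= opnorm T * `|v|.
Proof. by move=> [bT _]; exact: le_opnorm. Qed.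

Lemma positive_op_sum T n (g : 'I_n -> X) : positive_op T ->
  T (\sum_(i < n) g i) = \sum_(i < n) T (g i).
Proof.
move=> pT; elim: n g => [|n IH] g; first by rewrite !big_ord0 positive_op0.
rewrite !big_ord_recr /= -IH.
have := positive_op_lin 1 (\sum_(i < n) g (widen_ord (leqnSn n) i)) (g ord_max) pT.
by rewrite !scale1r.
Qed.

Lemma ble_sum n (g h : 'I_n -> X) : (forall i, g i <=: h i) ->
  \sum_(i < n) g i <=: \sum_(i < n) h i.
Proof. by move=> gh; elim/big_ind2: _ => // *; exact: bleD. Qed.

Lemma powset_sub F F' n : F `<=` F' -> powset F n `<=` powset F' n.
Proof.
move=> FF'; elim: n => [//|n IH] _ [g Fg [h Fh ->]].
by exists g; [exact: FF'|exists h => //; exact: IH].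
Qed.

Lemma powset_comp F m n S S' : powset F m S -> powset F n S' -> powset F (m + n) (S \o S').
Proof.
elim: m S => [|m IH] S /=; first by move=> ->.
move=> [g Fg [h Fh ->]] FS'; exists g => //; exists (h \o S') => //; exact: IH.
Qed.

Lemma powset_ind C n (P : (X -> X) -> Prop) : P idfun ->
  (forall g h, C g -> P h -> P (g \o h)) -> powset C n `<=` P.
Proof.
move=> P0 Pc; elim: n => [_ -> //|n IH] _ [g Cg [h Ch ->]].
by apply: Pc => //; exact: IH.
Qed.

Lemma powset_pos C n S : C `<=` positive_op -> powset C n S -> positive_op S.
Proof.
move=> Cpos; apply: (powset_ind (P := positive_op)).
  split; first by split=> //; exists 1 => w; rewrite mul1r.
  by move=> _ [w w0 <-].
move=> g h /Cpos pg ph; split; last first.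
  by move=> _ [w w0 <-]; apply: (positive_op_ge0 pg); exact: (positive_op_ge0 ph).
split; first by move=> a u w /=; rewrite !positive_op_lin.
exists (opnorm g * opnorm h) => w /=; apply: (le_trans (positive_op_norm _ pg)).
rewrite -mulrA; apply: ler_wpM2l; last exact: positive_op_norm.
by apply: opnorm_ge0; exact: pg.1.
Qed.

Lemma powset_finite C n S : powset C n S ->
  exists F, [/\ finite_set F, F `<=` C & powset F n S].
Proof.
elim: n S => [S -> |n IH _ [g Cg [h /IH[F [fF FC Fh]] ->]]].
  by exists set0; split=> //; exact: finite_set0.
exists ([set g] `|` F); split.
- by rewrite finite_setU; split => //; exact: finite_set1.
- by move=> T [->|/FC].
- exists g; first by left.
  by exists h => //; apply: powset_sub Fh => T; right.
Qed.

Lemma quasinilpotent_decay C x0 F e : finitely_quasinilpotent_at C x0 ->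
  finite_set F -> F `<=` C -> 0 < e ->
  exists N, forall n S, (N <= n)%N -> powset F n S -> `|S x0| <= e ^+ n.
Proof.
move=> qn fF FC e0; have := qn F fF FC => lim0.
have : (limn_esup (fun n : nat =>
      (set_norm [set T x0 | T in powset F n] `^ (n%:R^-1))%E) < e%:E)%E.
  by rewrite lim0 lte_fin.
move=> /ereal_inf_lt[_ [V [N _ NV] <-] Ve].
exists N.+1 => n S Nn FS.
have Vn : V n by apply: NV => /=; exact: ltnW.
have n0 : (0 < n)%N by exact: leq_trans Nn.
have h1 : (set_norm [set T x0 | T in powset F n] `^ (n%:R^-1) < e%:E)%E.
  by apply: le_lt_trans Ve; apply: ereal_sup_ubound; exists n.
have h2 : ((`|S x0|)%:E <= set_norm [set T x0 | T in powset F n])%E.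
  by apply: ereal_sup_ubound; exists (S x0) => //; exists S.
have h3 : ((`|S x0|)%:E `^ (n%:R^-1) < e%:E)%E.
  apply: le_lt_trans h1; apply: gt0_ler_poweR => //.
  by rewrite in_itv /= lee_fin normr_ge0 leey.
  by rewrite in_itv /= leey andbT; apply: le_trans h2; rewrite lee_fin.
move: h3; rewrite poweR_EFin lte_fin => h3.
rewrite -[X in X <= _](powRr1 (normr_ge0 _)) -[1](@mulVf _ (n%:R : R)) ?pnatr_eq0 -?lt0n//.
rewrite powRrM powR_mulrn ?powR_ge0//; apply: lerXn2r; rewrite ?nnegrE ?powR_ge0//.
  exact: ltW.
exact: ltW.
Qed.

(** The letters of [S] pass over [A] one by one, the positivity of the letters to
their left preserving the inequality. *)
Lemma commutant_powset C A n S v : C `<=` positive_op -> super_right_commutant C A ->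
  powset C n S -> 0 <=: v -> S (A v) <=: A (S v).
Proof.
move=> Cpos [pA sA] CS v0; have := CS; pose P S := positive_op S -> S (A v) <=: A (S v).
elim: n S CS => [_ -> _ //|n IH] _ [g Cg [h Ch ->]] _ /=.
apply: (ble_trans (positive_op_mono (Cpos _ Cg) (IH _ Ch Ch))).
have hv : 0 <=: h v by apply: positive_op_ge0 => //; exact: (powset_pos Cpos Ch).
by have := positive_op_ge0 (sA _ Cg) hv; rewrite /= -ble_sub0.
Qed.

(** Membership in [dominated_ops C] with quantitative data: the letters come from
the set [F], and the multipliers have total norm at most [k]. *)
Definition dominated_by C F k T := positive_op T /\
  exists (n : nat) (A S : 'I_n -> X -> X),
  [/\ forall i, super_right_commutant C (A i),
      forall i, exists2 m, (1 <= m)%N & powset F m (S i),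
      \sum_(i < n) opnorm (A i) <= k &
      forall v, 0 <=: v -> T v <=: \sum_(i < n) A i (S i v)].

Lemma dominated_by_sub C F F' k k' T : F `<=` F' -> k <= k' ->
  dominated_by C F k T -> dominated_by C F' k' T.
Proof.
move=> FF' kk' [pT [n [A [S [h1 h2 h3 h4]]]]]; split=> //; exists n, A, S; split=> //.
  by move=> i; have [m m1 Fm] := h2 i; exists m => //; exact: powset_sub Fm.
exact: le_trans kk'.
Qed.

Lemma dominated_finite C T : dominated_ops C T ->
  exists F k, [/\ finite_set F, F `<=` C & dominated_by C F k T].
Proof.
move=> [pT [n [A [S [_ cA cS dT]]]]].
have [m m1 cm] : exists2 m : 'I_n -> nat, forall i, (1 <= m i)%N & forall i, powset C (m i) (S i).
  have /choice[m hm] : forall i, exists m, (1 <= m)%N /\ powset C m (S i).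
    by move=> i; have [m ? ?] := cS i; exists m.
  by exists m => i; have [] := hm i.
have /choice[G hG] : forall i, exists F, [/\ finite_set F, F `<=` C & powset F (m i) (S i)].
  by move=> i; exact: powset_finite.
exists (\bigcup_i G i), (\sum_(i < n) opnorm (A i)); split.
- by apply: bigcup_finite => // i _; have [] := hG i.
- by move=> g [i _]; have [_ + _] := hG i; apply.
split=> //; exists n, A, S; split=> //.
  move=> i; exists (m i) => //; have [_ _] := hG i; apply: powset_sub.
  by move=> g Gg; exists i.
by move=> v v0; have := positive_op_ge0 dT v0; rewrite /= -ble_sub0.
Qed.

Lemma dominated_finite_seq C (l : seq (X -> X)) :
  (forall T, T \in l -> dominated_ops C T) ->
  exists F k, [/\ finite_set F, F `<=` C, 0 < k &
    forall T, T \in l -> dominated_by C F k T].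
Proof.
elim: l => [_|T l IH lC].
  by exists set0, 1; split=> //; exact: finite_set0.
have [F [k [fF FC k0 Fk]]] : exists F k, [/\ finite_set F, F `<=` C, 0 < k &
    forall T, T \in l -> dominated_by C F k T].
  by apply: IH => T' lT'; apply: lC; rewrite inE lT' orbT.
have [F' [k' [fF' FC' Fk']]] := dominated_finite (lC T (mem_head _ _)).
exists (F `|` F'), (Num.max k k'); split.
- by rewrite finite_setU.
- by move=> S [/FC|/FC'].
- by rewrite lt_max k0.
move=> T'; rewrite inE => /orP[/eqP->|/Fk].
  by apply: dominated_by_sub Fk' => [S ?|]; [right|rewrite le_max lexx orbT].
by apply: dominated_by_sub => [S ?|]; [left|rewrite le_max lexx].
Qed.

(** Expanding [u n] by the domination of [Tn (n - 1)], the commutant inequality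
moves the multipliers to the left, where they cost a factor [k], and the word
[S] grows by at least one letter. After [n] steps the words act on [u 0] and
have at least [L + n] letters. *)
Lemma iterated_decay C F k (Tn : nat -> X -> X) (u : nat -> X) b n L S :
  C `<=` positive_op -> F `<=` C -> 0 <= k -> 0 <= b -> (forall j, dominated_by C F k (Tn j)) ->
  0 <=: u 0%N -> (forall j, u j.+1 = Tn j (u j)) ->
  (forall L' S', (L + n <= L')%N -> powset F L' S' -> `|S' (u 0%N)| <= b) ->
  powset F L S -> `|S (u n)| <= k ^+ n * b.
Proof.
move=> Cpos FC k0 b0 dT u0 uS.
have uge j : 0 <=: u j.
  by elim: j => // j IH; rewrite uS; apply: positive_op_ge0 => //; have [] := dT j.
elim: n L S => [|n IH] L S ub FS; first by rewrite mul1r; apply: (ub L) => //; rewrite addn0.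
have [pT [p [A [Q [cA FQ sA Tle]]]]] := dT n.
have CS : powset C L S by exact: powset_sub FS.
have pS : positive_op S by exact: (powset_pos Cpos CS).
have le1 : S (u n.+1) <=: \sum_(i < p) A i (S (Q i (u n))).
  rewrite uS; apply: (ble_trans (positive_op_mono pS (Tle _ (uge n)))).
  rewrite positive_op_sum//; apply: ble_sum => i.
  have [m _ FQi] := FQ i.
  have pQ : positive_op (Q i).
    by apply: (powset_pos Cpos (n := m)); exact: powset_sub FQi.
  by apply: (commutant_powset Cpos (cA i) CS); exact: positive_op_ge0.
have Sge : 0 <=: S (u n.+1) by exact: positive_op_ge0.
apply: (le_trans (norm_mono Sge le1)).
apply: (@le_trans _ _ (\sum_(i < p) opnorm (A i) * (k ^+ n * b))).
  apply: (le_trans (ler_norm_sum _ _ _)); apply: ler_sum => i _.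
  have pA : positive_op (A i) by have [] := cA i.
  apply: (le_trans (positive_op_norm _ pA)); apply: ler_wpM2l.
    by apply: opnorm_ge0; have [] := pA.
  have [m m1 FQi] := FQ i.
  apply: (IH (L + m)%N (S \o Q i)); last exact: powset_comp.
  move=> L' S' LL'; apply: ub; apply: leq_trans LL'.
  by rewrite addnS -addSn leq_add2r -addn1 leq_add2l.
rewrite -mulr_suml exprS -mulrA; apply: ler_wpM2r => //.
by rewrite mulr_ge0// exprn_ge0.
Qed.

Definition order_ball x0 r : set X :=
  [set z | [/\ 0 <=: z, z <=: x0 & `|x0 - z| <= r]].

(** Otherwise every [z] of the order ball has some [T] in the list such that
[T z \m x0] is in the order ball again, since [x0 - T z \m x0] is the positive
part of [x0 - T z]. Iterating gives vectors of norm at least [`|x0| - r], below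
vectors that tend to 0 by [iterated_decay]. *)
Lemma quasinilpotent_fip C x0 r (l : seq (X -> X)) : C `<=` positive_op ->
  0 <=: x0 -> finitely_quasinilpotent_at C x0 -> 0 <= r -> r < `|x0| ->
  (forall T, T \in l -> dominated_ops C T) ->
  exists2 z, order_ball x0 r z & forall T, T \in l -> r < `|pospart (x0 - T z)|.
Proof.
move=> Cpos x0ge qn r0 rx0 lC; apply: contrapT => nz.
have /choice[tau htau] : forall z, exists T, order_ball x0 r z ->
    T \in l /\ `|pospart (x0 - T z)| <= r.
  move=> z; have [Uz|nUz] := pselect (order_ball x0 r z); last by exists idfun.
  apply: contrapT => nT; apply: nz; exists z => // T lT; rewrite ltNge; apply/negP => Tr.
  by apply: nT; exists T.
pose step z := tau z z \m x0; pose Z n := iter n step x0; pose Tn n := tau (Z n).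
pose u := nat_rect (fun=> X) x0 (fun n v => Tn n v).
have [F [k [fF FC k0 dk]]] := dominated_finite_seq lC.
have UZ n : order_ball x0 r (Z n).
  elim: n => [|n IH] /=; first by split=> //; rewrite subrr normr0.
  have [lT Tr] := htau _ IH; have [Zge Zx0 _] := IH.
  split; [|exact: ble_meetr|].
    apply: meet_ge0 => //; apply: positive_op_ge0 => //.
    by have [] := lC _ lT.
  by rewrite /step bl_meetC meetE opprB addrC subrK; exact: Tr.
have lT n : Tn n \in l by have [] := htau _ (UZ n).
have pT n : positive_op (Tn n) by have [] := lC _ (lT n).
have Zu n : Z n <=: u n.
  elim: n => [|n IH] /=; first exact: ble_refl.
  apply: (ble_trans (ble_meetl _ _)); exact: positive_op_mono.
(* The [n] steps cost [k ^+ n], against a decay of [e ^+ n]: take [k * e] at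
   most [2^-1]. *)
have e0 : 0 < Num.min 1 (2 * k)^-1 by rewrite lt_min ltr01 invr_gt0 mulr_gt0.
set e := Num.min _ _ in e0.
have [N hN] := quasinilpotent_decay qn fF FC e0.
have uN n : (N <= n)%N -> `|u n| <= 2^-1 ^+ n.
  move=> Nn; have /(_ 0%N idfun) := @iterated_decay C F k Tn u (e ^+ n) n _ _ Cpos FC
    (ltW k0) (exprn_ge0 n (ltW e0)) (fun j => dk _ (lT j)) x0ge (fun j => erefl).
  move=> h; apply: (le_trans (h _ _)) => //.
    move=> L' S' nL FS; apply: (le_trans (hN _ _ (leq_trans Nn nL) FS)).
    by apply: ler_wiXn2l => //; [exact: ltW|rewrite ge_min lexx].
  rewrite -exprMn; apply: lerXn2r; rewrite ?nnegrE ?invr_ge0//.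
    by rewrite mulr_ge0// ltW.
  have : e <= (2 * k)^-1 by rewrite ge_min lexx orbT.
  move=> /(ler_wpM2l (ltW k0)) /le_trans; apply.
  by rewrite invfM mulrCA mulfV ?gt_eqF// mulr1.
have eta0 : 0 < `|x0| - r by rewrite subr_gt0.
have low n : `|x0| - r <= `|u n|.
  have [Zge _ Zr] := UZ n; apply: le_trans (norm_mono Zge (Zu n)).
  rewrite lerBlDr; apply: (le_trans _ (lerD (lexx _) Zr)).
  by apply: le_trans (ler_normD _ _); rewrite addrC subrK.
have /archi_boundP : 0 <= (`|x0| - r)^-1 by rewrite invr_ge0 ltW.
set K := (X in _ < X%:R) => hK.
have h1 := le_trans (low (N + K)%N) (uN (N + K)%N (leq_addr _ _)).
have h2 : (K%:R : R) < 2 ^+ (N + K).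
  rewrite -natrX ltr_nat; apply: (leq_ltn_trans (leq_addl N K)); exact: ltn_expl.
have h3 : 2 ^+ (N + K) <= (`|x0| - r)^-1.
  rewrite -[X in X <= _]invrK lef_pV2 ?posrE ?invr_gt0 ?exprn_gt0//.
  by rewrite -exprVn.
by have := lt_trans hK h2; rewrite ltNge h3.
Qed.
End Quasinilpotence.

(** * Sums and multiples of dominated operators *)

Section DominatedCone.
Context {R : realType} {X : banachLatticeType R}.
Implicit Types (T A : X -> X) (C : set (X -> X)).

Lemma positive_opD T T' : positive_op T -> positive_op T' -> positive_op (fun x => T x + T' x).
Proof.
move=> pT pT'; split; last first.
  move=> _ [v v0 <-]; exact: (bleD_ge0 (positive_op_ge0 pT v0) (positive_op_ge0 pT' v0)).
split.
  by move=> a u v /=; rewrite (positive_op_lin _ _ _ pT) (positive_op_lin _ _ _ pT'); lmod.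
exists (opnorm T + opnorm T') => v; apply: (le_trans (ler_normD _ _)).
by rewrite mulrDl; apply: lerD; exact: positive_op_norm.
Qed.

Lemma positive_opZ T (a : R) : 0 < a -> positive_op T -> positive_op (fun x => a *: T x).
Proof.
move=> a0 pT; split; last first.
  by move=> _ [v v0 <-]; apply: bl_scale_ge0; [exact: ltW|exact: positive_op_ge0].
split; first by move=> b u v /=; rewrite (positive_op_lin _ _ _ pT); lmod.
exists (a * opnorm T) => v; rewrite normrZ gtr0_norm// -mulrA; apply: ler_wpM2l.
  exact: ltW.
exact: positive_op_norm.
Qed.

Lemma le_opD T S T' S' : le_op S T -> le_op S' T' ->
  le_op (fun x => S x + S' x) (fun x => T x + T' x).
Proof.
move=> h h'; have := positive_opD h h'; rewrite /le_op; congr positive_op.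
by apply/funext => x /=; lmod.
Qed.

Lemma le_opZ T S (a : R) : 0 < a -> le_op S T ->
  le_op (fun x => a *: S x) (fun x => a *: T x).
Proof.
move=> a0 h; have := positive_opZ a0 h; rewrite /le_op; congr positive_op.
by apply/funext => x /=; rewrite scalerBr.
Qed.

Lemma dominated_opsD C T T' : dominated_ops C T -> dominated_ops C T' ->
  dominated_ops C (fun x => T x + T' x).
Proof.
move=> [pT [k [A [S [k1 cA cS dT]]]]] [pT' [k' [A' [S' [_ cA' cS' dT']]]]].
split; first exact: positive_opD.
pose glue (G : 'I_k -> X -> X) (G' : 'I_k' -> X -> X) (i : 'I_(k + k')) :=
  match fintype.split i with inl j => G j | inr j => G' j end.
exists (k + k')%N, (glue A A'), (glue S S'); split.
- exact: leq_trans (leq_addr _ _).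
- by move=> i; rewrite /glue; case: fintype.splitP => j _.
- by move=> i; rewrite /glue; case: fintype.splitP => j _.
- have := le_opD dT dT'; rewrite /le_op; congr positive_op.
  apply/funext => x /=; congr (_ - _).
  rewrite big_split_ord /=; congr (_ + _); apply: eq_bigr => i _; rewrite /glue.
    case: fintype.splitP => j /= ij; first by rewrite (ord_inj ij).
    by have := ltn_ord i; rewrite ij ltnNge leq_addr.
  case: fintype.splitP => j /= ij; first by have := ltn_ord j; rewrite -ij ltnNge leq_addr.
  by move/addnI: ij => /ord_inj ->.
Qed.

Lemma dominated_opsZ C T (a : R) : C `<=` positive_op -> 0 < a -> dominated_ops C T ->
  dominated_ops C (fun x => a *: T x).
Proof.
move=> Cpos a0 [pT [k [A [S [k1 cA cS dT]]]]].
split; first exact: positive_opZ.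
exists k, (fun i x => a *: A i x), S; split=> //.
  move=> i; have [pA sA] := cA i; split; first exact: positive_opZ.
  move=> Q CQ; have := positive_opZ a0 (sA Q CQ); rewrite /le_op; congr positive_op.
  apply/funext => x /=; rewrite scalerBr; congr (_ - _).
  have := positive_op_lin a (A i x) 0 (Cpos _ CQ).
  by rewrite (positive_op0 (Cpos _ CQ)) !addr0.
have := le_opZ a0 dT; rewrite /le_op; congr positive_op.
by apply/funext => x /=; rewrite scaler_sumr.
Qed.
End DominatedCone.

(** * The vector and the functional *)

Section MainArgument.
Context {R : realType} {X : banachLatticeType R} {Y : completeNormedModType R}.
Context {iota : X -> Y -> R^o} (XY : dual_identification iota).
Implicit Types (x y z u v : X) (T S A : X -> X) (C : set (X -> X)) (r e mu : R).

Lemma predual_positive_vector x : x <> 0 -> exists w, 0 < (iota x w : R).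
Proof.
move=> x0; apply: contrapT => nw; apply: x0; apply: norm_le0.
apply: (iota_norm_le XY) => w _; rewrite normr_le0.
apply/eqP/le_anti/andP; split; rewrite leNgt; apply/negP => h; apply: nw; first by exists w.
exists (- w); have [lin _] := iota_dual XY x.
have i0 : iota x 0 = 0 by have := lin (-1) 0 0; rewrite scaler0 addr0 scaleN1r addNr.
by have := lin (-1) w 0; rewrite scaleN1r i0 !addr0 scaleN1r => ->; rewrite oppr_gt0.
Qed.

Lemma midconvex_order_ball x0 r : midconvex (order_ball x0 r).
Proof.
have x0E : x0 = 2^-1 *: (x0 + x0) by rewrite -mulr2n -scalerMnr double_half.
move=> x y [x1 x2 x3] [y1 y2 y3]; split.
- by apply: bl_scale_ge0 => //; exact: bleD_ge0.
- by rewrite [X in _ <=: X]x0E; apply: bleZ => //; exact: bleD.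
- have -> : x0 - 2^-1 *: (x + y) = 2^-1 *: ((x0 - x) + (x0 - y)).
    by rewrite [X in X - _]x0E -scalerBr; congr (_ *: _); lmod.
  rewrite normrZ gtr0_norm ?invr_gt0// ler_pdivrMl//.
  by apply: (le_trans (ler_normD _ _)); lra.
Qed.

(** The vectors [- W m] increase to 0 and so converge to 0 weak-star. *)
Lemma ess_bounded_decreasing (T : X -> X) mu (W : nat -> X) x e :
  positive_op T -> ess_bounded (iota := iota) T mu ->
  (forall m, 0 <=: W m) -> (forall m, W m <=: x) -> (forall m, W m.+1 <=: W m) ->
  (forall v, 0 <=: v -> (forall m, v <=: W m) -> v = 0) -> 0 < e ->
  exists m, `|T (W m)| <= `|x| * mu + e.
Proof.
move=> pT bT Wge Wx Wdec Winf e0.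
have Wle m n : (m <= n)%N -> W n <=: W m.
  move=> /subnK <-; elim: (n - m)%N => [|k IH]; first exact: ble_refl.
  by apply: ble_trans IH; rewrite addSn.
pose S := [set - W m | m in [set: nat]].
have S0 : exists v, S v by exists (- W 0%N), 0%N.
have dirS : directed S.
  move=> _ _ [m _ <-] [n _ <-]; exists (- W (maxn m n)); split; first by exists (maxn m n).
    by apply: bleN; apply: Wle; exact: leq_maxl.
  by apply: bleN; apply: Wle; exact: leq_maxr.
have Sub : upper_bound S 0.
  by move=> _ [m _ <-]; apply: (ble_lin (Wge m) _); lmod.
have [s [[Ss sS] [G [FG tailG Gs]]]] := directed_supremum XY S0 dirS Sub.
have s0 : s = 0.
  have : - s = 0.
    apply: Winf; first by apply: (ble_lin (sS _ Sub) _); lmod.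
    by move=> m; have h := Ss _ (ex_intro2 _ _ m I erefl); apply: (ble_lin h _); lmod.
  by move=> /eqP; rewrite oppr_eq0 => /eqP.
have GS : G S.
  have [v Sv] := S0; apply: filterS (tailG _ Sv) => z [//].
have GD : G [set v | `|v - s| <= `|x|].
  apply: filterS GS => _ [m _ <-] /=; rewrite s0 subr0 normrN; exact: norm_mono.
have [_ [[m _ <-] /= h]] := filter_ex (filterI GS (ess_bounded_wlim XY bT Gs GD e0)).
exists m; move: h; rewrite s0 -positive_opB// subr0.
by rewrite -[- W m]sub0r positive_opB// positive_op0// sub0r normrN.
Qed.

Lemma quasinilpotent_ultrafilter C x0 r : C `<=` positive_op -> 0 <=: x0 ->
  finitely_quasinilpotent_at C x0 -> 0 <= r -> r < `|x0| ->
  exists (G : set_system X) z, [/\ ProperFilter G, wlim iota G z, G (order_ball x0 r) &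
    forall T, dominated_ops C T -> G [set y | r < `|pospart (x0 - T y)|]].
Proof.
move=> Cpos x0ge qn r0 rx0.
pose D := [set l : seq (X -> X) | forall T, T \in l -> dominated_ops C T].
pose V (l : seq (X -> X)) := order_ball x0 r `&`
  [set y | forall T, T \in l -> r < `|pospart (x0 - T y)|].
have FF : ProperFilter (filter_from D V).
  apply: filter_from_proper; last first.
    by move=> l Dl; have [z Uz hz] := quasinilpotent_fip Cpos x0ge qn r0 rx0 Dl; exists z.
  apply: filter_from_filter; first by exists [::].
  move=> l l' Dl Dl'; exists (l ++ l').
    by move=> T; rewrite mem_cat => /orP[/Dl|/Dl'].
  move=> y [Uy hy]; split; split=> // T Tl; apply: hy; rewrite mem_cat Tl ?orbT//.
have [G [GU FG]] := ultraFilterLemma FF.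
have GV l : D l -> G (V l) by move=> Dl; apply: FG; exists l => //; exact: subset_refl.
have GB : G (order_ball x0 r) by apply: filterS (GV [::] _) => // y [].
have Gr : G [set x | `|x| <= `|x0|].
  by apply: filterS GB => y [y0 yx _] /=; exact: norm_mono.
have [z Gz] := ultra_wlim XY Gr.
exists G, z; split=> // [|T dT]; first exact: ultra_proper.
have DT : D [:: T] by move=> S; rewrite inE => /eqP ->.
by apply: filterS (GV _ DT) => y [_ h]; apply: h; rewrite inE.
Qed.

Lemma pospart_ess_bounded_limit T mu (G : set_system X) {FG : ProperFilter G} x0 z d r :
  positive_op T -> ess_bounded (iota := iota) T mu -> wlim iota G z ->
  G [set y | `|y - z| <= d] -> G [set y | r < `|pospart (x0 - T y)|] ->
  r <= `|pospart (x0 - T z)| + d * mu.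
Proof.
move=> pT bT Gz Gd Gr; apply/ler_addgt0Pr => e e0.
have [y [/= h1 h2]] := filter_ex (filterI Gr (ess_bounded_wlim XY bT Gz Gd e0)).
apply: (le_trans (ltW h1)); rewrite -addrA; apply: le_trans (lerD (lexx _) h2).
have -> : x0 - T y = (x0 - T z) + (- (T y - T z)) by lmod.
apply: (@le_trans _ _ `|pospart (x0 - T z) + pospart (- (T y - T z))|).
  by apply: norm_mono => //; exact: pospartD_le.
apply: (le_trans (ler_normD _ _)); rewrite lerD2l -[X in _ <= X]normrN; exact: norm_pospart.
Qed.

(** By [ess_bounded_wlim], the lower bound [r] for the [`|pospart (x0 - T y)|]
becomes [`|pospart (x0 - T z)| + d * mu >= r] at the limit [z]; the pairs
[(T z, mu)] form the cone to which [separating_functional] applies. *)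
Lemma limit_functional C x0 z (G : set_system X) {FG : ProperFilter G} d r :
  C `<=` positive_op -> 0 <= d -> 0 < r -> r <= `|pospart x0| ->
  wlim iota G z -> G [set y | `|y - z| <= d] ->
  (forall T, dominated_ops C T -> G [set y | r < `|pospart (x0 - T y)|]) ->
  exists f : X -> R, [/\ forall a u v, f (a *: u + v) = a * f u + f v,
    forall v, f v <= `|pospart v|, 0 < f x0 &
    forall T mu, dominated_ops C T -> ess_bounded (iota := iota) T mu -> f (T z) <= mu].
Proof.
move=> Cpos d0 r0 rx0 Gz Gd Gr.
pose K T mu := dominated_ops C T /\ ess_bounded (iota := iota) T mu.
pose P : set (X * R) := [set p | p = (0, 0) \/ exists2 T, K T p.2 & p.1 = T z].
have d1 : 0 < d + 1 by rewrite ltr_wpDl.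
(* [(d + 1) * (t + mu) >= t + d * mu >= r], [t] being the norm at the limit. *)
have [] := @separating_functional R X P x0 (r / (d + 1)).
- by left.
- move=> u mu u' mu' [[-> ->]|[T /= [dT bT] ->]]; first by rewrite !add0r.
  move=> [[-> ->]|[T' /= [dT' bT'] ->]]; first by rewrite !addr0; right; exists T.
  right; exists (fun x => T x + T' x) => //; split; first exact: dominated_opsD.
  exact: (ess_boundedD XY).
- move=> a u mu a0 [[-> ->]|[T /= [dT bT] ->]]; first by left; rewrite scaler0 mulr0.
  right; exists (fun x => a *: T x) => //; split; first exact: dominated_opsZ.
  exact: (ess_boundedZ XY).
- by move=> u mu [[_ ->]//|[T /= [_ bT] _]]; exact: ess_bounded_ge0 bT.
- move=> u mu [[-> ->]|[T /= [dT bT] ->]]; rewrite ler_pdivrMr//.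
    rewrite subr0 addr0; apply: (le_trans rx0); rewrite ler_peMr// lerDr//.
  have h : r <= `|pospart (x0 - T z)| + d * mu.
    by exact: (pospart_ess_bounded_limit dT.1 bT Gz Gd (Gr T dT)).
  have mu0 := ess_bounded_ge0 bT.
  apply: (le_trans h); rewrite mulrDl !mulrDr !mulr1 (mulrC mu).
  have : 0 <= `|pospart (x0 - T z)| * d by apply: mulr_ge0.
  lra.
move=> f [flin fpos fx0 fP]; exists f; split=> //.
- by apply: lt_le_trans fx0; rewrite divr_gt0.
- by move=> T mu dT bT; apply: fP; right; exists T.
Qed.

(** The radius [r] is small enough for [phi] to be at least [phi x0 / 2] on the
order ball, so that [order_selection] yields a nonzero vector. *)
Lemma dominated_bound C x0 : C `<=` positive_op -> 0 <=: x0 -> x0 <> 0 ->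
  finitely_quasinilpotent_at C x0 ->
  exists x (f : X -> R) (k : R), [/\ 0 <=: x, x <> 0, 0 < k,
    [/\ forall a u v, f (a *: u + v) = a * f u + f v,
    forall v, f v <= `|pospart v| & f x0 > 0] &
    forall T mu, dominated_ops C T -> ess_bounded (iota := iota) T mu -> f (T x) <= k * mu].
Proof.
move=> Cpos x0ge x0n qn.
have [w iw] := predual_positive_vector x0n.
pose phi := predual_pos (iota := iota) w.
have phi0 : 0 < phi x0 by exact: lt_le_trans iw (predual_pos_ge XY w x0ge (ble_refl x0)).
have nx0 : 0 < `|x0| by rewrite normr_gt0; apply/eqP.
have nw : 0 < `|w|.
  have := lt_le_trans phi0 (predual_pos_norm XY w x0ge).
  by rewrite pmulr_rgt0.
pose r := Num.min (`|x0| / 2) (phi x0 / (2 * `|w|)).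
have r0 : 0 < r by rewrite lt_min !divr_gt0// mulr_gt0.
have rx0 : r < `|x0|.
  by apply: (@le_lt_trans _ _ (`|x0| / 2)); [rewrite ge_min lexx|lra].
have rw : r * `|w| <= phi x0 / 2.
  apply: (@le_trans _ _ (phi x0 / (2 * `|w|) * `|w|)).
    by apply: ler_wpM2r => //; rewrite ge_min lexx orbT.
  by rewrite invfM mulrA -mulrA mulVf ?mulr1// gt_eqF.
have phiU z : order_ball x0 r z -> phi x0 / 2 <= phi z.
  move=> [z0 zx zr].
  have d0 : 0 <=: x0 - z by rewrite -ble_sub0.
  have := predual_posD XY w z0 d0; rewrite addrC subrK -/phi => e.
  have := predual_pos_norm XY w d0.
  by have := ler_wpM2r (ltW nw) zr; move: rw e; rewrite /phi; lra.
have [G [z [FG Gz GB GT]]] := quasinilpotent_ultrafilter Cpos x0ge qn (ltW r0) rx0.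
pose d := `|x0| + `|z|.
have d0 : 0 <= d by apply: addr_ge0.
have Gd : G [set y | `|y - z| <= d].
  apply: filterS GB => y [y0 yx _] /=; apply: (le_trans (ler_normB _ _)).
  by apply: lerD => //; exact: norm_mono.
have rp : r <= `|pospart x0| by rewrite (pospart_idl x0ge) ltW.
have [f [flin fpos fx0 fT]] := limit_functional Cpos d0 r0 rp Gz Gd GT.
have fle v : f v <= `|v| by apply: (le_trans (fpos v)); exact: norm_pospart.
have fD u v : f (u + v) = f u + f v by rewrite -[u]scale1r flin mul1r scale1r.
have fZ a v : f (a *: v) = a * f v.
  have f0 : f 0 = 0 by have := flin (-1) 0 0; rewrite scaler0 addr0; lra.
  by rewrite -[a *: v]addr0 flin f0 addr0.
pose F0 := [set A | midconvex A /\ G A].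
have bF0 : convex_base F0.
  split=> [A [cA GA]|A A' [cA GA] [cA' GA']].
    by split=> //; exact: filter_ex GA.
  split; last exact: filterI.
  by move=> u v [Au A'u] [Av A'v]; split; [exact: cA|exact: cA'].
have FB : F0 (order_ball x0 r) by split=> //; exact: midconvex_order_ball.
have Bx0 y : order_ball x0 r y -> 0 <=: y /\ y <=: x0 by move=> [].
have c0 : 0 < phi x0 / 2 by rewrite divr_gt0.
have [x [x_ge xx0 xn sel]] := order_selection XY bF0 FB Bx0 c0 phiU.
exists x, f, (1 + d + `|x0|); split=> //; first by rewrite -addrA ltr_wpDr// addr_ge0.
move=> T mu dT bT; have pT := dT.1; have mu0 := ess_bounded_ge0 bT.
apply/ler_addgt0Pr => e e0; have e2 : 0 < e / 2 by rewrite divr_gt0.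
pose A := [set y | f (T y) <= (1 + d) * mu + e / 2].
have FA : F0 A.
  split.
    move=> u v; rewrite /A /= => fu fv; have -> : T (2^-1 *: (u + v)) = 2^-1 *: (T u + T v).
      have := positive_op_lin 2^-1 u (2^-1 *: v) pT; rewrite -scalerDr => ->.
      have := positive_op_lin 2^-1 v 0 pT; rewrite (positive_op0 pT) !addr0 => ->.
      by rewrite -scalerDr.
    by rewrite fZ fD; lra.
  apply: filterS (ess_bounded_wlim XY bT Gz Gd e2) => y /= h.
  have := fle (T y - T z); have := fT T mu dT bT; have := fD (T y - T z) (T z).
  by rewrite /A /= subrK mulrDl mul1r; lra.
have [W [W0 Wx Wdec Winf Wsel]] := sel A FA.
have [m hm] := ess_bounded_decreasing pT bT W0 Wx Wdec Winf e2.
have [y /= fy xy] := Wsel m.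
have fmono : f (T (x - W m)) <= f (T y).
  have := fpos (T (x - W m) - T y); have := fD (T (x - W m) - T y) (T y); rewrite subrK => ->.
  have -> : pospart (T (x - W m) - T y) = 0.
    apply: ble_anti => //; apply: join_ble => //.
    by apply: (ble_lin (positive_op_mono pT xy) _); lmod.
  by rewrite normr0; lra.
have xm : `|x| * mu <= `|x0| * mu by apply: ler_wpM2r => //; exact: norm_mono.
have := fD (T (x - W m)) (T (W m)); rewrite positive_opB// subrK => ->.
have := fle (T (W m)); move: fmono; rewrite positive_opB//.
by move: fy hm xm; rewrite /A /= !mulrDl; lra.
Qed.
End MainArgument.

Theorem theorem7 (R : realType) (X : banachLatticeType R)
    (Y : completeNormedModType R) (iota : X -> Y -> R^o)
    (XY : dual_identification iota)
    (C : set (X -> X))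
    (Cpos : C `<=` positive_op)
    (Cadj : C `<=` adjoint_op iota)
    (x0 : X) (x0_ge0 : positive_cone x0) (x0_neq0 : x0 <> 0)
    (Cqn : finitely_quasinilpotent_at C x0) :
  exists (x : X) (f : X -> R^o),
    [/\ positive_cone x, x <> 0, positive_dual f, f <> (fun _ => 0)
      & forall T : X -> X, adjoint_dominated_ops iota C T ->
          (f (T x) : R) <= essnorm (preadjoint iota T)].
Proof.
have [x [f [k [x_ge xn k0 [flin fpos fx0] fT]]]] :=
  dominated_bound XY Cpos x0_ge0 x0_neq0 Cqn.
have f0 : f 0 = 0 by have := flin (-1) 0 0; rewrite scaler0 addr0; lra.
have fN v : f (- v) = - f v.
  by have := flin (-1) v 0; rewrite scaleN1r addr0 f0; lra.
exists x, (fun v => k^-1 * f v); split=> //.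
- split; last first.
    move=> v v0; apply: mulr_ge0; first by rewrite invr_ge0 ltW.
    have := fpos (- v); rewrite fN.
    have -> : pospart (- v) = 0.
      apply: ble_anti; last exact: pospart_ge0.
      apply: join_ble; last exact: ble_refl.
      by apply: (ble_lin v0 _); lmod.
    by rewrite normr0; lra.
  split; first by move=> a u v; rewrite flin /GRing.scale /=; ring.
  exists k^-1 => v; rewrite normrM gtr0_norm ?invr_gt0//; apply: ler_wpM2l.
    by rewrite invr_ge0 ltW.
  have := le_trans (fpos v) (norm_pospart v).
  have := le_trans (fpos (- v)) (norm_pospart (- v)).
  by rewrite fN normrN ler_norml; lra.
- move=> /(congr1 (fun g => g x0)) /eqP; rewrite mulf_eq0 invr_eq0 !gt_eqF//.
- move=> T [dT aT]; rewrite ler_pdivrMl//.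
  by apply: fT => //; exact: ess_bounded_essnorm.
Qed.
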